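(* The discriminant of the quaternary cubic $$a\,xyz+b\,xyw+c\,xzw+d\,yzw+e\,x^2y+f\,xy^2+g\,z^2w+h\,zw^2$$ is the degree $32$ polynomial $$2^{16}3^{5}\cdot e^2f^2g^2h^2\cdot(ac-eg)^2\cdot(ad-fg)^2\cdot(bc-eh)^2\cdot(bd-fh)^2\cdot\Delta_{\mathcal{A}},$$ where $\mathcal{A}$ is the set of exponent vectors of the eight monomials $xyz,xyw,xzw,yzw,x^2y,xy^2,z^2w,zw^2$ and $\Delta_{\mathcal{A}}$ is the $\mathcal{A}$-discriminant. The $\mathcal{A}$-discriminant has $49$ terms of degree $8$, namely $$\begin{aligned} \Delta_{\mathcal{A}}={}&a^4b^2h^2-2a^3b^3gh-2a^3b^2cdh-2a^3bcfh^2-2a^3bdeh^2+4a^3efh^3+a^2b^4g^2-2a^2b^3cdg\\ &+a^2b^2c^2d^2+8a^2b^2cfgh+8a^2b^2degh+4a^2bc^2dfh+4a^2bcd^2eh-6a^2befgh^2+a^2c^2f^2h^2\\ &-10a^2cdefh^2+a^2d^2e^2h^2-2ab^3cfg^2-2ab^3deg^2+4ab^2c^2dfg+4ab^2cd^2eg-6ab^2efg^2h\\ &-2abc^3d^2f-2abc^2d^3e-10abc^2f^2gh-26abcdefgh-10abd^2e^2gh-2ac^3df^2h+8ac^2d^2efh\\ &-2acd^3e^2h+18acef^2gh^2+18ade^2fgh^2+4b^3efg^3+b^2c^2f^2g^2-10b^2cdefg^2+b^2d^2e^2g^2\\ &-2bc^3df^2g+8bc^2d^2efg-2bcd^3e^2g+18bcef^2g^2h+18bde^2fg^2h+c^4d^2f^2-2c^3d^3ef\\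 &+4c^3f^3gh+c^2d^4e^2-6c^2def^2gh-6cd^2e^2fgh+4d^3e^3gh-27e^2f^2g^2h^2. \end{aligned}$$
   Context: The coefficients $a,\dots,h$ are indeterminates. The discriminant of a cubic form in four variables $x,y,z,w$ is the degree $32$ polynomial in its $20$ coefficients that vanishes precisely when the cubic surface in $\mathbb{P}^3$ is singular; here it is computed as the resultant of the four partial derivatives of the cubic, using Nanson's formula, which writes the resultant of four quaternary quadrics as the determinant of a $20\times 20$ matrix, and it is specialized to the cubics with the eight given monomials. The $\mathcal{A}$-discriminant $\Delta_{\mathcal{A}}$ is the irreducible polynomial with integer coefficients in $a,\dots,h$ (unique up to sign) defining the closure of the set of coefficient vectors for which the polynomial has a singular point in the torus where $xyzw\neq 0$. *)

(* Defs.v *)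
From mathcomp Require Import all_boot all_order all_algebra.
From mathcomp Require Export mpoly.

Set Implicit Arguments.
Unset Strict Implicit.
Unset Printing Implicit Defensive.

Import GRing.Theory Num.Theory.
Local Open Scope ring_scope.

Section Discriminant.
Variable R : comNzRingType.
Implicit Types (Q : 'I_4 -> {mpoly R[4]}) (F : {mpoly R[4]}).

Definition jacobian Q : {mpoly R[4]} :=
  \det (\matrix_(i < 4, j < 4) (Q i)^`M(j)).

(* For quadrics Q_0, ..., Q_3: the sixteen cubics x_i Q_j, followed by the    *)
(* four partial derivatives of the Jacobian determinant.                      *)
Definition nanson_rows Q : seq {mpoly R[4]} :=
  [seq 'X_i * Q j | i <- enum 'I_4, j <- enum 'I_4]
  ++ [seq (jacobian Q)^`M(k) | k <- enum 'I_4].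

(* The twenty cubic monomials, x_i x_j^2 and then (x_0 x_1 x_2 x_3) / x_k.     *)
(* They are listed parallel to nanson_rows: for Q_j = x_j^2, each row is a    *)
(* multiple of the monomial in the same position.                             *)
Definition nanson_cols : seq 'X_{1..4} :=
  [seq (U_(i) + U_(j) *+ 2)%MM | i <- enum 'I_4, j <- enum 'I_4]
  ++ [seq [multinom (i != k : nat) | i < 4] | k <- enum 'I_4].

(* The determinant of this matrix is 2^16 times the resultant of the Q_j,     *)
(* normalized to be 1 at Q_j = x_j^2.                                         *)
Definition nanson_mx Q : 'M[R]_20 :=
  \matrix_(r, s) (nth 0 (nanson_rows Q) r)@_(nth 0%MM nanson_cols s).

(* The discriminant is defined only up to sign, as the order of the rows and  *)
(* columns of Nanson's matrix is not prescribed. The sign taken here is that  *)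
(* of nanson_mx with two rows interchanged: it is negative at the Fermat      *)
(* cubic over the reals.                                                      *)
Definition cubic_discriminant F : R :=
  - \det (nanson_mx (fun j => F^`M(j))).

End Discriminant.

Definition irreducible_element (R : unitRingType) (p : R) : Prop :=
  [/\ p != 0, p \isn't a GRing.unit
    & forall q r : R, p = q * r -> q \is a GRing.unit \/ r \is a GRing.unit].

Section ADiscriminant.
Variables (C : numClosedFieldType) (n m : nat) (A : n.-tuple 'X_{1..m}).

Definition sparse_poly (c : 'I_n -> C) : {mpoly C[m]} :=
  \sum_(i < n) c i *: 'X_[tnth A i].

Definition has_singular_torus_point (c : 'I_n -> C) : Prop :=
  exists x : 'I_m -> C,
    [/\ forall j, x j != 0,
        (sparse_poly c).@[x] = 0
      & forall j, ((sparse_poly c)^`M(j)).@[x] = 0].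

Definition zariski_closure (S : ('I_n -> C) -> Prop) (c : 'I_n -> C) : Prop :=
  forall P : {mpoly C[n]}, (forall s, S s -> P.@[s] = 0) -> P.@[c] = 0.

(* A-discriminants are unique up to sign. Irreducibility is meant in the ring *)
(* of polynomials over the integers, so it forces primitivity.                *)
Definition is_A_discriminant (D : {mpoly int[n]}) : Prop :=
  irreducible_element D /\
  forall c : 'I_n -> C,
    (map_mpoly (intr : int -> C) D).@[c] = 0
      <-> zariski_closure has_singular_torus_point c.

End ADiscriminant.

Arguments is_A_discriminant C {n m} A D.

(* In the variables x, y, z, w: xyz, xyw, xzw, yzw, x^2 y, x y^2, z^2 w, z w^2 *)
Definition eight_monomials : 8.-tuple 'X_{1..4} :=
  [tuple [multinom [tuple 1; 1; 1; 0]]; [multinom [tuple 1; 1; 0; 1]];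
         [multinom [tuple 1; 0; 1; 1]]; [multinom [tuple 0; 1; 1; 1]];
         [multinom [tuple 2; 1; 0; 0]]; [multinom [tuple 1; 2; 0; 0]];
         [multinom [tuple 0; 0; 2; 1]]; [multinom [tuple 0; 0; 1; 2]]]%N.

(* Main.v *)
Require Import Defs.
From mathcomp Require Import all_boot all_order all_algebra.
From HB Require Import structures.
From mathcomp Require Import all_fingroup ring.

Set Implicit Arguments.
Unset Strict Implicit.
Unset Printing Implicit Defensive.

Import GRing.Theory Num.Theory.
Local Open Scope ring_scope.

(** Write F for the cubic with coefficients a, ..., h and Delta for the
    polynomial [delta].

    The discriminant.  In Nanson's matrix, the derivatives of the Hessian
    determinant of F are combinations of the products x_i Q_j of a variable and
    a partial derivative, up to a combination of the four squarefree monomials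
    xyzw/x_k ([hessian_det_derivative_coords]).  So the matrix is a unit lower
    triangular matrix times a block upper triangular one ([nanson_mx_cubic]),
    and its determinant is the product of a 16 x 16 and a 4 x 4 determinant.
    Six row operations make the first block triangular up to a permutation; it
    gives 9 e^2 f^2 g^2 h^2 times the product of the four binomials
    ([det_nanson_top]).  The second one gives -27 * 16^4 times the same product
    times Delta ([det_nanson_schur]).

    Delta vanishes at singular cubics.  The torus moves a singular point to
    (1, 1, 1, 1), where singularity is a system of linear conditions with an
    explicit four-dimensional solution space, and Delta is zero on that space
    ([delta_torus], [delta_kernel], [singular_delta]).

    Generic zeros of Delta come from singular cubics.  At the point
    (s, 1, t lambda, lambda), F is for each lambda a conic in (s, t) through
    the origin.  The determinant of twice its symmetric matrix is 2 lambda^3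
    times a cubic D in lambda, and the discriminant of D is (bd - fh)^2 Delta
    ([disc3_conic_pencil]).  A zero of Delta thus gives a double root lambda of
    D, so a singular conic; as lambda is a double root, the derivative of F
    along lambda also vanishes at the singular point of the conic
    ([singular_torus_point]).

    These zeros are dense: a polynomial P that vanishes at all singular cubics
    is divisible by Delta ([delta_dvd]).  Divide P by Delta, a cubic in h with
    leading coefficient 4 a^3 e f; the remainder has degree at most 2 in h, and
    for generic a, ..., g it has the three distinct roots of Delta, so it is
    zero.  The powers of a, e, f that the pseudo-division brought in cancel,
    because Delta does not vanish identically on a = 0, e = 0 or f = 0.

    Irreducibility over the integers ([delta_mpoly_irreducible]).  If one factor
    of Delta has degree 1 in h, then so it has modulo 3 at a point where the
    leading coefficient survives, but there Delta becomes x^3 + x^2 + x + 2,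
    which has no root in F_3.  So one factor is free of h.  It divides the
    leading coefficients of Delta in h and in g, hence lies in Z[e, f], and two
    specializations of Delta to polynomials in e and f that differ by 1 show
    that it is a unit.

    Support and degrees are read off from the list of the 49 terms. *)

(** * The polynomial Delta as a discriminant *)

Section Forms.
Variable R : comNzRingType.
Implicit Types a b c d e f g h l m n k : R.

(** Over an arbitrary ring, so that the same expression can be evaluated at
    scalars, at indeterminates and at constant polynomials. *)
Definition delta a b c d e f g h : R :=
    a ^+ 4 * b ^+ 2 * h ^+ 2 - 2 * a ^+ 3 * b ^+ 3 * g * h
      - 2 * a ^+ 3 * b ^+ 2 * c * d * h - 2 * a ^+ 3 * b * c * f * h ^+ 2
      - 2 * a ^+ 3 * b * d * e * h ^+ 2 + 4 * a ^+ 3 * e * f * h ^+ 3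
      + a ^+ 2 * b ^+ 4 * g ^+ 2 - 2 * a ^+ 2 * b ^+ 3 * c * d * g
      + a ^+ 2 * b ^+ 2 * c ^+ 2 * d ^+ 2 + 8 * a ^+ 2 * b ^+ 2 * c * f * g * h
      + 8 * a ^+ 2 * b ^+ 2 * d * e * g * h
      + 4 * a ^+ 2 * b * c ^+ 2 * d * f * h
      + 4 * a ^+ 2 * b * c * d ^+ 2 * e * h
      - 6 * a ^+ 2 * b * e * f * g * h ^+ 2 + a ^+ 2 * c ^+ 2 * f ^+ 2 * h ^+ 2
      - 10 * a ^+ 2 * c * d * e * f * h ^+ 2 + a ^+ 2 * d ^+ 2 * e ^+ 2 * h ^+ 2
      - 2 * a * b ^+ 3 * c * f * g ^+ 2 - 2 * a * b ^+ 3 * d * e * g ^+ 2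
      + 4 * a * b ^+ 2 * c ^+ 2 * d * f * g
      + 4 * a * b ^+ 2 * c * d ^+ 2 * e * g
      - 6 * a * b ^+ 2 * e * f * g ^+ 2 * h - 2 * a * b * c ^+ 3 * d ^+ 2 * f
      - 2 * a * b * c ^+ 2 * d ^+ 3 * e - 10 * a * b * c ^+ 2 * f ^+ 2 * g * h
      - 26 * a * b * c * d * e * f * g * h
      - 10 * a * b * d ^+ 2 * e ^+ 2 * g * h - 2 * a * c ^+ 3 * d * f ^+ 2 * h
      + 8 * a * c ^+ 2 * d ^+ 2 * e * f * h - 2 * a * c * d ^+ 3 * e ^+ 2 * h
      + 18 * a * c * e * f ^+ 2 * g * h ^+ 2
      + 18 * a * d * e ^+ 2 * f * g * h ^+ 2 + 4 * b ^+ 3 * e * f * g ^+ 3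
      + b ^+ 2 * c ^+ 2 * f ^+ 2 * g ^+ 2 - 10 * b ^+ 2 * c * d * e * f * g ^+ 2
      + b ^+ 2 * d ^+ 2 * e ^+ 2 * g ^+ 2 - 2 * b * c ^+ 3 * d * f ^+ 2 * g
      + 8 * b * c ^+ 2 * d ^+ 2 * e * f * g - 2 * b * c * d ^+ 3 * e ^+ 2 * g
      + 18 * b * c * e * f ^+ 2 * g ^+ 2 * h
      + 18 * b * d * e ^+ 2 * f * g ^+ 2 * h + c ^+ 4 * d ^+ 2 * f ^+ 2
      - 2 * c ^+ 3 * d ^+ 3 * e * f + 4 * c ^+ 3 * f ^+ 3 * g * h
      + c ^+ 2 * d ^+ 4 * e ^+ 2 - 6 * c ^+ 2 * d * e * f ^+ 2 * g * h
      - 6 * c * d ^+ 2 * e ^+ 2 * f * g * h + 4 * d ^+ 3 * e ^+ 3 * g * h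
      - 27 * e ^+ 2 * f ^+ 2 * g ^+ 2 * h ^+ 2.

(** The discriminant of l X^3 + m X^2 + n X + k. *)
Definition disc3 l m n k : R :=
  m ^+ 2 * n ^+ 2 - 4 * l * n ^+ 3 - 4 * m ^+ 3 * k + 18 * l * m * n * k
  - 27 * l ^+ 2 * k ^+ 2.

(** The cubic whose discriminant is taken is K U V - e X V^2 - g U^2, where
    K = a + c X, U = f + b X and V = d + h X.  It is, up to a constant multiple
    of X^3, the determinant of the conic in (s, t) that the cubic form defines
    at (s, 1, t X, X). *)
Lemma disc3_conic_pencil a b c d e f g h :
  disc3 (b * c * h - e * h ^+ 2)
        (a * b * h + c * f * h + b * c * d - 2 * d * e * h - b ^+ 2 * g)
        (a * f * h + a * b * d + c * d * f - d ^+ 2 * e - 2 * b * f * g)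
        (a * d * f - f ^+ 2 * g)
  = (b * d - f * h) ^+ 2 * delta a b c d e f g h.
Proof. by rewrite /disc3 /delta; ring. Qed.

End Forms.

(** * Explicit matrices and 4 x 4 determinants *)

Definition mxtab (R : nzRingType) m n (t : seq (seq R)) : 'M[R]_(m, n) :=
  \matrix_(i < m, j < n) nth 0 (nth [::] t i) j.

(** The Laplace expansion along the first two rows.  Entries are indexed by
    [nat], so that they compute. *)
Definition det4 (R : comNzRingType) (m : nat -> nat -> R) : R :=
  let top i j := m 0%N i * m 1%N j - m 0%N j * m 1%N i in
  let bot i j := m 2%N i * m 3%N j - m 2%N j * m 3%N i in
  top 0%N 1%N * bot 2%N 3%N - top 0%N 2%N * bot 1%N 3%N
  + top 0%N 3%N * bot 1%N 2%N + top 1%N 2%N * bot 0%N 3%N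
  - top 1%N 3%N * bot 0%N 2%N + top 2%N 3%N * bot 0%N 1%N.

(** Expansion along the first row, with entries indexed by [nat]: unlike the
    determinant of a matrix over ordinals, it unfolds by computation. *)
Fixpoint laplace (R : comNzRingType) n (F : nat -> nat -> R) : R :=
  if n is n'.+1 then
    \sum_(k < n) (-1) ^+ k * F 0%N k * laplace n' (fun i j => F i.+1 (bump k j))
  else 1.

Lemma det_laplace (R : comNzRingType) n (F : nat -> nat -> R) :
  \det (\matrix_(i < n, j < n) F i j) = laplace n F.
Proof.
elim: n F => [|n IHn] F; first exact: det_mx00.
rewrite (expand_det_row _ ord0); apply: eq_bigr => k _.
rewrite mxE /cofactor add0n mulrCA mulrA; congr (_ * _).
rewrite -[RHS]IHn; congr (\det _).
by apply/matrixP => i j; rewrite !mxE.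
Qed.

Lemma det_mx44 (R : comNzRingType) (m : nat -> nat -> R) :
  \det (\matrix_(i < 4, j < 4) m i j) = det4 m.
Proof.
rewrite det_laplace /= !big_ord_recl !big_ord0 /= /bump /=.
by rewrite !(addn0, add0n, add1n) /det4; ring.
Qed.

Lemma forall_ord4 (P : 'I_4 -> Prop) :
  P 0 -> P 1 -> P 2 -> P 3 -> forall i, P i.
Proof.
by move=> P0 P1 P2 P3 [[|[|[|[|//]]]] ilt];
  [move: P0|move: P1|move: P2|move: P3]; congr P; apply: val_inj.
Qed.

Lemma enum_ord4 : enum 'I_4 = [:: 0; 1; 2; 3].
Proof. by apply: (inj_map val_inj); rewrite val_enum_ord. Qed.

Lemma mderivXU (R : comNzRingType) n (i j : 'I_n) :
  ('X_i : {mpoly R[n]})^`M(j) = (i == j)%:R.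
Proof.
rewrite mderivX mnm1E; case: eqP => [->|_]; last by rewrite scale0r.
by rewrite scale1r -{1}[U_(j)%MM]add0m addmK mpolyX0.
Qed.

Lemma mpolyXU_neq0 (R : nzRingType) n (i : 'I_n) : 'X_i != 0 :> {mpoly R[n]}.
Proof. by rewrite -msize_poly_eq0 msizeX. Qed.

(** Multinomials are opaque to computation, the lists of their exponents are
    not. *)
Lemma uniq_nanson_cols : uniq nanson_cols.
Proof.
pose key (m : 'X_{1..4}) := [:: m 0; m 1; m 2; m 3].
have kD (i j : 'I_4) : key (U_(i) + U_(j) *+ 2)%MM
  = [:: (i == 0%R) + ((j == 0%R) + (j == 0%R));
        (i == 1%R) + ((j == 1%R) + (j == 1%R));
        (i == 2%R) + ((j == 2%R) + (j == 2%R));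
        (i == 3%R) + ((j == 3%R) + (j == 3%R))]%N.
  by rewrite /key !mnmDE !mnm1E.
have kC (k : 'I_4) : key [multinom (i != k : nat) | i < 4]
  = [:: 0%R != k : nat; 1%R != k : nat; 2%R != k : nat; 3%R != k : nat].
  by rewrite /key !mnmE.
apply: (@map_uniq _ _ key).
rewrite /nanson_cols enum_ord4 map_cat map_allpairs -map_comp (eq_map kC).
by rewrite (eq_allpairs _ _ kD).
Qed.

Lemma prod_ord4 (R : comNzRingType) (F : 'I_4 -> R) :
  \prod_i F i = F 0 * F 1 * F 2 * F 3.
Proof.
rewrite !big_ord_recl big_ord0 mulr1 !mulrA.
by congr (_ * F _ * F _ * F _); apply: val_inj.
Qed.

(** * Nanson's matrix of the cubic *)

Section Tables.
Variables (R : comNzRingType) (a b c d e f g h : R).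

(** Row 4 i + j holds the coordinates of x_i Q_j, where Q_j is the j-th partial
    derivative of the cubic, in the monomials x_m x_n^2, at position 4 m + n,
    followed by yzw, xzw, xyw, xyz. *)
Definition nanson_top : seq (seq R) :=
  [:: [:: 0; f; 0; 0; 2*e; 0; 0; 0; 0; 0; 0; 0; 0; 0; 0; 0; 0; c; b; a];
    [:: e; 0; 0; 0; 2*f; 0; 0; 0; a; 0; 0; 0; b; 0; 0; 0; 0; d; 0; 0];
    [:: 0; 0; 0; h; a; 0; 0; 0; 0; 0; 0; 0; c; 0; 0; 0; 0; 2*g; d; 0];
    [:: 0; 0; g; 0; b; 0; 0; 0; c; 0; 0; 0; 0; 0; 0; 0; 0; 2*h; 0; d];
    [:: 0; 2*e; 0; 0; 0; f; 0; 0; 0; a; 0; 0; 0; b; 0; 0; c; 0; 0; 0];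
    [:: 0; 2*f; 0; 0; e; 0; 0; 0; 0; 0; 0; 0; 0; 0; 0; 0; d; 0; b; a];
    [:: 0; a; 0; 0; 0; 0; 0; h; 0; 0; 0; 0; 0; d; 0; 0; 2*g; 0; c; 0];
    [:: 0; b; 0; 0; 0; 0; g; 0; 0; d; 0; 0; 0; 0; 0; 0; 2*h; 0; 0; c];
    [:: 0; 0; 0; 0; 0; 0; a; 0; 0; f; 0; 0; 0; 0; c; 0; b; 0; 0; 2*e];
    [:: 0; 0; a; 0; 0; 0; 0; 0; e; 0; 0; 0; 0; 0; d; 0; 0; b; 0; 2*f];
    [:: 0; 0; 0; 0; 0; 0; 0; 0; 0; 0; 0; h; 0; 0; 2*g; 0; d; c; 0; a];
    [:: 0; 0; c; 0; 0; 0; d; 0; 0; 0; g; 0; 0; 0; 2*h; 0; 0; 0; 0; b];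
    [:: 0; 0; 0; 0; 0; 0; 0; b; 0; 0; 0; c; 0; f; 0; 0; a; 0; 2*e; 0];
    [:: 0; 0; 0; b; 0; 0; 0; 0; 0; 0; 0; d; e; 0; 0; 0; 0; a; 2*f; 0];
    [:: 0; 0; 0; c; 0; 0; 0; d; 0; 0; 0; 2*g; 0; 0; 0; h; 0; 0; a; 0];
    [:: 0; 0; 0; 0; 0; 0; 0; 0; 0; 0; 0; 2*h; 0; 0; g; 0; d; c; b; 0]].

(** Row k holds a quarter of the coefficients by which the x_i Q_j enter the
    k-th derivative of the Hessian determinant.  They are found by eliminating
    the sixteen monomials x_i x_j^2: Cramer's rule would give them the
    determinant of the first sixteen columns of [nanson_top] as a denominator,
    but all denominators cancel. *)
Definition nanson_syzygy : seq (seq R) :=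
  [:: [:: 4*a*b*c - 4*a*e*h - 4*b*e*g - 4*c^+2*f + 4*c*d*e; 4*c^+2*e; -
        4*b*c*e + 8*e^+2*h; - 4*a*c*e + 8*e^+2*g; - a*b*d + 2*c*d*f +
        d^+2*e; - 3*a*b*c + 3*c^+2*f - 2*c*d*e; 4*e*f*h; 4*e*f*g; a^+2*h -
        2*a*b*g - a*c*d + 4*c*f*g; 4*c*e*g; a*b*c - 4*a*e*h + 4*b*e*g -
        c^+2*f - 2*c*d*e; 4*a*e*g; - 2*a*b*h + b^+2*g - b*c*d + 4*c*f*h;
        4*c*e*h; 4*b*e*h; a*b*c + 4*a*e*h - 4*b*e*g - c^+2*f - 2*c*d*e];
    [:: - 3*a*b*d - 2*c*d*f + 3*d^+2*e; - a*b*c + c^+2*f + 2*c*d*e; 4*e*f*h;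
        4*e*f*g; 4*d^+2*f; 4*a*b*d - 4*a*f*h - 4*b*f*g + 4*c*d*f - 4*d^+2*e;
        - 4*b*d*f + 8*f^+2*h; - 4*a*d*f + 8*f^+2*g; 4*d*f*g; a^+2*h -
        2*a*b*g - a*c*d + 4*d*e*g; a*b*d - 4*a*f*h + 4*b*f*g - 2*c*d*f -
        d^+2*e; 4*a*f*g; 4*d*f*h; - 2*a*b*h + b^+2*g - b*c*d + 4*d*e*h;
        4*b*f*h; a*b*d + 4*a*f*h - 4*b*f*g - 2*c*d*f - d^+2*e];
    [:: - a^+2*h - 2*a*b*g + a*c*d - 4*c*f*g + 4*d*e*g; 4*c*e*g; - a*b*c +
        4*a*e*h + c^+2*f - 2*c*d*e; 4*a*e*g; 4*d*f*g; - a^+2*h - 2*a*b*g +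
        a*c*d + 4*c*f*g - 4*d*e*g; - a*b*d + 4*a*f*h - 2*c*d*f + d^+2*e;
        4*a*f*g; - 4*a*d*g + 8*f*g^+2; - 4*a*c*g + 8*e*g^+2; - 4*a^+2*h +
        4*a*b*g + 4*a*c*d - 4*c*f*g - 4*d*e*g; 4*a^+2*g; 4*f*g*h; 4*e*g*h;
        2*a*b*h + b^+2*g - b*c*d; 3*a^+2*h - 2*a*b*g - 3*a*c*d];
    [:: - 2*a*b*h - b^+2*g + b*c*d - 4*c*f*h + 4*d*e*h; 4*c*e*h; 4*b*e*h; -
        a*b*c + 4*b*e*g + c^+2*f - 2*c*d*e; 4*d*f*h; - 2*a*b*h - b^+2*g +
        b*c*d + 4*c*f*h - 4*d*e*h; 4*b*f*h; - a*b*d + 4*b*f*g - 2*c*d*f +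
        d^+2*e; 4*f*g*h; 4*e*g*h; - 2*a*b*h + 3*b^+2*g - 3*b*c*d; a^+2*h +
        2*a*b*g - a*c*d; - 4*b*d*h + 8*f*h^+2; - 4*b*c*h + 8*e*h^+2;
        4*b^+2*h; 4*a*b*h - 4*b^+2*g + 4*b*c*d - 4*c*f*h - 4*d*e*h]].

(** Row k holds a sixteenth of the coordinates of what then remains of the k-th
    derivative, in yzw, xzw, xyw, xyz.  This is the Schur complement of the
    leading 16 x 16 block of Nanson's matrix. *)
Definition nanson_schur : seq (seq R) :=
  [:: [:: a*b*c*d + a*d*e*h + b*d*e*g - c^+2*d*f + c*d^+2*e - 3*e*f*g*h; -
        2*a*b*c^+2 + 4*a*c*e*h + 4*b*c*e*g + 2*c^+3*f - 2*c^+2*d*e -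
        6*e^+2*g*h; - a*b^+2*c - a*b*e*h + 2*b^+2*e*g + b*c^+2*f + 2*b*c*d*e
        - 3*c*e*f*h; - a^+2*b*c + 2*a^+2*e*h - a*b*e*g + a*c^+2*f +
        2*a*c*d*e - 3*c*e*f*g];
    [:: - 2*a*b*d^+2 + 4*a*d*f*h + 4*b*d*f*g - 2*c*d^+2*f + 2*d^+3*e -
        6*f^+2*g*h; a*b*c*d + a*c*f*h + b*c*f*g + c^+2*d*f - c*d^+2*e -
        3*e*f*g*h; - a*b^+2*d - a*b*f*h + 2*b^+2*f*g + 2*b*c*d*f + b*d^+2*e
        - 3*d*e*f*h; - a^+2*b*d + 2*a^+2*f*h - a*b*f*g + 2*a*c*d*f +
        a*d^+2*e - 3*d*e*f*g];
    [:: a^+2*d*h + 2*a*b*d*g - a*c*d^+2 - 3*a*f*g*h - c*d*f*g + 2*d^+2*e*g;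
        a^+2*c*h + 2*a*b*c*g - a*c^+2*d - 3*a*e*g*h + 2*c^+2*f*g - c*d*e*g;
        - a^+2*b*h + a*b^+2*g + a*b*c*d + b*c*f*g + b*d*e*g - 3*e*f*g*h;
        2*a^+3*h - 2*a^+2*b*g - 2*a^+2*c*d + 4*a*c*f*g + 4*a*d*e*g -
        6*e*f*g^+2];
    [:: 2*a*b*d*h + b^+2*d*g - b*c*d^+2 - 3*b*f*g*h - c*d*f*h + 2*d^+2*e*h;
        2*a*b*c*h + b^+2*c*g - b*c^+2*d - 3*b*e*g*h + 2*c^+2*f*h - c*d*e*h;
        - 2*a*b^+2*h + 2*b^+3*g - 2*b^+2*c*d + 4*b*c*f*h + 4*b*d*e*h -
        6*e*f*h^+2; a^+2*b*h - a*b^+2*g + a*b*c*d + a*c*f*h + a*d*e*h -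
        3*e*f*g*h]].

Section Forms.
Variables x y z w : R.

Definition cubic : R :=
  a * (x * y * z) + b * (x * y * w) + c * (x * z * w) + d * (y * z * w)
    + e * (x ^+ 2 * y) + f * (x * y ^+ 2)
    + g * (z ^+ 2 * w) + h * (z * w ^+ 2).

Definition partials : seq R :=
  [:: 2 * e * x * y + f * y ^+ 2 + a * y * z + b * y * w + c * z * w;
      e * x ^+ 2 + 2 * f * x * y + a * x * z + b * x * w + d * z * w;
      a * x * y + c * x * w + d * y * w + 2 * g * z * w + h * w ^+ 2;
      b * x * y + c * x * z + d * y * z + g * z ^+ 2 + 2 * h * z * w].

Definition hessian : seq (seq R) :=
  [:: [:: 2 * e * y; 2 * e * x + 2 * f * y + a * z + b * w; a * y + c * w;
          b * y + c * z];
      [:: 2 * e * x + 2 * f * y + a * z + b * w; 2 * f * x; a * x + d * w;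
          b * x + d * z];
      [:: a * y + c * w; a * x + d * w; 2 * g * w;
          c * x + d * y + 2 * g * z + 2 * h * w];
      [:: b * y + c * z; b * x + d * z; c * x + d * y + 2 * g * z + 2 * h * w;
          2 * h * z]].

Definition third_derivatives : seq (seq (seq R)) :=
  [:: [:: [:: 0; 2 * e; 0; 0]; [:: 2 * e; 2 * f; a; b]; [:: 0; a; 0; c];
          [:: 0; b; c; 0]];
      [:: [:: 2 * e; 2 * f; a; b]; [:: 2 * f; 0; 0; 0]; [:: a; 0; 0; d];
          [:: b; 0; d; 0]];
      [:: [:: 0; a; 0; c]; [:: a; 0; 0; d]; [:: 0; 0; 0; 2 * g];
          [:: c; d; 2 * g; 2 * h]];
      [:: [:: 0; b; c; 0]; [:: b; 0; d; 0]; [:: c; d; 2 * g; 2 * h];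
          [:: 0; 0; 2 * h; 0]]].

Definition cubic_monomials : seq R :=
  [:: x ^+ 3; x * y ^+ 2; x * z ^+ 2; x * w ^+ 2;
      y * x ^+ 2; y ^+ 3; y * z ^+ 2; y * w ^+ 2;
      z * x ^+ 2; z * y ^+ 2; z ^+ 3; z * w ^+ 2;
      w * x ^+ 2; w * y ^+ 2; w * z ^+ 2; w ^+ 3;
      y * z * w; x * z * w; x * y * w; x * y * z].

Definition multiples : seq R := [seq t * q | t <- [:: x; y; z; w], q <- partials].

Definition hessian_det_derivative (k : nat) : R :=
  \sum_(r < 4) det4 (fun i j =>
    if i == r then (nth [::] (nth [::] third_derivatives i) j)`_k
    else (nth [::] hessian i)`_j).

End Forms.
End Tables.

(** For an arbitrary morphism [phi] and arbitrary x, y, z, w rather than for the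
    embedding of constants into polynomials and the indeterminates, so that
    [ring] sees plain variables. *)
Section Coordinates.
Variables (R P : comNzRingType) (phi : {rmorphism R -> P}).
Variables (a b c d e f g h : R) (x y z w : P).

Local Notation on_form t :=
  (t P (phi a) (phi b) (phi c) (phi d) (phi e) (phi f) (phi g) (phi h) x y z w)
  (only parsing).

Fixpoint dot (u : seq R) (v : seq P) : P :=
  match u, v with p :: u', q :: v' => phi p * q + dot u' v' | _, _ => 0 end.

Lemma sum_nth_mul n (u : seq R) (v : seq P) : (size v <= n)%N ->
  \sum_(s < n) phi u`_s * v`_s = dot u v.
Proof.
elim: n u v => [|n IHn] u [|q v] //=; first by rewrite big_ord0; case: u.
  by rewrite big1 => [|s _]; [case: u | rewrite nth_nil mulr0].
case: u => [|p u]; rewrite ltnS => le_vn.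
  by rewrite big1 // => s _; rewrite nth_nil rmorph0 mul0r.
by rewrite big_ord_recl /= IHn.
Qed.

Lemma multiples_coords (r : nat) : (r < 16)%N ->
  (on_form (@multiples))`_r
  = \sum_(s < 20) phi (nth [::] (nanson_top a b c d e f g h) r)`_s
      * (cubic_monomials x y z w)`_s.
Proof.
move=> r16; rewrite sum_nth_mul //.
do 16![case: r r16 => [|r] r16; first by rewrite /=; ring].
by [].
Qed.

(** This is what makes Nanson's matrix factor into blocks. *)
Lemma hessian_det_derivative_coords (k : nat) : (k < 4)%N ->
  on_form (@hessian_det_derivative) k
  = \sum_(r < 16) 4 * phi (nth [::] (nanson_syzygy a b c d e f g h) k)`_r
      * (on_form (@multiples))`_r
    + \sum_(s < 4) 16 * phi (nth [::] (nanson_schur a b c d e f g h) k)`_s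
        * (cubic_monomials x y z w)`_(16 + s).
Proof.
move=> k4; rewrite /hessian_det_derivative.
have sumE n (u : seq R) (v : seq P) m : (size v <= n)%N ->
  \sum_(s < n) m * phi u`_s * v`_s = m * dot u v.
  move=> le_vn; rewrite -(sum_nth_mul u le_vn) mulr_sumr.
  by under eq_bigr do rewrite -mulrA.
set schur := nth [::] (nanson_schur _ _ _ _ _ _ _ _) k.
have -> : \sum_(s < 4) 16 * phi schur`_s * (cubic_monomials x y z w)`_(16 + s)
    = 16 * dot schur (drop 16 (cubic_monomials x y z w)).
  rewrite -(sumE 4%N _ (drop 16 (cubic_monomials x y z w)) 16 isT).
  by apply: eq_bigr => s _; rewrite nth_drop.
rewrite (sumE 16%N _ (on_form (@multiples)) 4 isT) !big_ord_recl big_ord0.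
rewrite {}/schur.
do 4![case: k k4 => [|k] k4; first by rewrite /det4 /=; ring].
by [].
Qed.
End Coordinates.

Lemma size_nanson_cols : size nanson_cols = 20.
Proof. by rewrite /nanson_cols enum_ord4. Qed.

(** The monomials are distinct, so the coordinates of a row are determined by
    any expression of it as their combination. *)
Lemma nanson_mx_coords (R : comNzRingType) (Q : 'I_4 -> {mpoly R[4]})
    (A : 'M[R]_(16 + 4)) :
  (forall r : 'I_(16 + 4), (nanson_rows Q)`_r
     = \sum_(s < 16 + 4) A r s *: 'X_[nth 0%MM nanson_cols s]) ->
  nanson_mx Q = A :> 'M_(16 + 4).
Proof.
move=> rowsE; apply/matrixP => r s; rewrite mxE rowsE raddf_sum /=.
rewrite (bigD1 s) //= mcoeffZ mcoeffX eqxx mulr1 big1 ?addr0 // => t ts.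
rewrite mcoeffZ mcoeffX nth_uniq ?uniq_nanson_cols ?size_nanson_cols //.
by rewrite (inj_eq val_inj) (negPf ts) mulr0.
Qed.

(** Leibniz' rule, row by row. *)
Lemma mderiv_det4 (R : comNzRingType) n (m : nat -> nat -> {mpoly R[n]}) k :
  (det4 m)^`M(k)
  = \sum_(r < 4) det4 (fun i j => if i == r then (m i j)^`M(k) else m i j).
Proof.
rewrite !big_ord_recl big_ord0 /det4 /= /bump /= ?(addn0, add1n) /=.
by rewrite !(mderivD, mderivN, mderivM); ring.
Qed.

Lemma eq_det4 (P : comNzRingType) (m m' : nat -> nat -> P) :
  (forall i j, (i < 4)%N -> (j < 4)%N -> m i j = m' i j) -> det4 m = det4 m'.
Proof. by move=> eqm; rewrite /det4 !eqm. Qed.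

Lemma nth_cat_addn (T : Type) (x0 : T) s t n k : size s = n ->
  nth x0 (s ++ t) (n + k) = nth x0 t k.
Proof. by move=> <-; rewrite nth_cat ltnNge leq_addr /= addKn. Qed.

Section Cubic.
Variables (R : comNzRingType) (a b c d e f g h : R).

Local Notation on_coefs t :=
  (t {mpoly R[4]} a%:MP b%:MP c%:MP d%:MP e%:MP f%:MP g%:MP h%:MP) (only parsing).
Local Notation on_form t := (on_coefs t 'X_0 'X_1 'X_2 'X_3) (only parsing).

Local Notation F := (on_form (@cubic)).
Local Notation P := (on_form (@partials)).
Local Notation H := (on_form (@hessian)).

Lemma mderiv_cubic (i : 'I_4) : F^`M(i) = P`_i.
Proof.
rewrite /cubic !expr2 !(mderivD, mderiv_mulC, mderivM, mderivXU).
by move: i; apply: forall_ord4 => /=; ring.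
Qed.

Lemma mderiv_partials (i j : 'I_4) : P`_i^`M(j) = (nth [::] H i)`_j.
Proof.
move: i j.
by apply: forall_ord4 => j; rewrite /= ?expr2 -?mulrA -?(mpolyC_nat 4 R 2)
  !(mderivD, mderiv_mulC, mderivM, mderivXU); move: j;
  apply: forall_ord4 => /=; rewrite ?mpolyC_nat; ring.
Qed.

Lemma mderiv_hessian (i j k : 'I_4) :
  (nth [::] H i)`_j^`M(k)
  = (nth [::] (nth [::] (on_coefs (@third_derivatives)) i) j)`_k.
Proof.
move: i j k.
by apply: forall_ord4; apply: forall_ord4 => k; rewrite /= -?mulrA
  -?(mpolyC_nat 4 R 2) !(mderivD, mderiv_mulC, mderivM, mderivXU); move: k;
  apply: forall_ord4 => /=; rewrite ?mpolyC_nat; ring.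
Qed.

Lemma jacobian_cubic_deriv (k : 'I_4) :
  (jacobian (fun j => F^`M(j)))^`M(k) = on_form (@hessian_det_derivative) k.
Proof.
have -> : jacobian (fun j => F^`M(j)) = det4 (fun i j => (nth [::] H i)`_j).
  rewrite -det_mx44; congr (\det _); apply/matrixP => i j.
  by rewrite !mxE mderiv_cubic mderiv_partials.
rewrite mderiv_det4; apply: eq_bigr => r _; apply: eq_det4 => i j i4 j4.
case: eqP => // _; exact: (mderiv_hessian (Ordinal i4) (Ordinal j4)).
Qed.

Lemma nanson_rows_cubic :
  nanson_rows (fun j => F^`M(j))
  = on_form (@multiples)
    ++ [seq on_form (@hessian_det_derivative) k | k <- iota 0 4].
Proof.
rewrite /nanson_rows; congr (_ ++ _).
  rewrite (eq_allpairs (f2 := fun i j : 'I_4 => 'X_i * P`_j)).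
    by rewrite enum_ord4.
  by move=> i j; rewrite mderiv_cubic.
by rewrite (eq_map jacobian_cubic_deriv) enum_ord4.
Qed.

Lemma nanson_cols_monomials :
  [seq 'X_[m] | m <- nanson_cols]
  = cubic_monomials 'X_0 'X_1 'X_2 'X_3 :> seq {mpoly R[4]}.
Proof.
rewrite /nanson_cols enum_ord4 map_cat map_allpairs -map_comp.
rewrite (eq_allpairs (f2 := fun i j => 'X_i * 'X_j ^+ 2 : {mpoly R[4]}));
  last by move=> i j; rewrite mpolyXD mpolyXn.
rewrite /= !mpolyXE_id !prod_ord4 !mnmE /=.
by rewrite -!exprS !(expr0, expr1, mul1r, mulr1).
Qed.

Lemma nanson_mx_cubic :
  nanson_mx (fun j => F^`M(j))
  = col_mx (mxtab 16 (16 + 4) (nanson_top a b c d e f g h))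
      (4 *: mxtab 4 16 (nanson_syzygy a b c d e f g h)
         *m mxtab 16 (16 + 4) (nanson_top a b c d e f g h)
       + row_mx 0 (16 *: mxtab 4 4 (nanson_schur a b c d e f g h)))
  :> 'M_(16 + 4, 16 + 4).
Proof.
have nth_colsE s : (s < 20)%N ->
    'X_[nth 0%MM nanson_cols s]
    = (cubic_monomials 'X_0 'X_1 'X_2 'X_3)`_s :> {mpoly R[4]}.
  move=> s20.
  by rewrite -nanson_cols_monomials (nth_map 0%MM) ?size_nanson_cols.
have topE (r : 'I_16) :
    (on_form (@multiples))`_r
    = \sum_(s < 16 + 4) mxtab 16 (16 + 4) (nanson_top a b c d e f g h) r s
        *: 'X_[nth 0%MM nanson_cols s].
  rewrite (multiples_coords (@mpolyC 4 R)) //; apply: eq_bigr => s _.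
  by rewrite mxE nth_colsE ?mul_mpolyC.
apply: nanson_mx_coords => r; rewrite nanson_rows_cubic.
case: (@split_ordP 16 4 r) => [{}r ->|k ->].
  rewrite nth_cat /= ltn_ord topE.
  by apply: eq_bigr => s _; rewrite col_mxEu.
have nthE : [seq on_form (@hessian_det_derivative) i | i <- iota 0 4]`_k
    = on_form (@hessian_det_derivative) k.
  by case: k => [[|[|[|[|k]]]] k4].
rewrite (@nth_cat_addn _ _ _ _ 16) // nthE.
rewrite (hessian_det_derivative_coords (@mpolyC 4 R)) //.
under [RHS]eq_bigr => s _ do rewrite col_mxEd mxE scalerDl.
rewrite big_split /=; congr (_ + _).
  under eq_bigr => q _ do rewrite topE mulr_sumr.
  rewrite exchange_big; apply: eq_bigr => s _.
  rewrite mxE scaler_suml; apply: eq_bigr => q _.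
  by rewrite !mxE -!mul_mpolyC !rmorphM /= mpolyC_nat !mulrA.
rewrite [RHS]big_split_ord [X in _ = X + _]big1 ?add0r => [|s _]; last first.
  by rewrite row_mxEl mxE scale0r.
apply: eq_bigr => s _; rewrite row_mxEr !mxE nth_colsE ?ltn_add2l //.
by rewrite -mul_mpolyC rmorphM /= mpolyC_nat.
Qed.
End Cubic.

(** * Determinants of matrices triangular up to a permutation *)

Section PermTrig.
Variables (R : comNzRingType) (n : nat).
Implicit Types (A : 'M[R]_n) (rank : 'I_n -> nat).

(** A permutation t whose term in the Leibniz formula is nonzero satisfies
    rank (t i) <= rank (s i) for all i, with equality only where t i = s i.
    Both sides have the same sum, so t = s. *)
Lemma det_perm_trig A (s : 'S_n) rank :
  (forall i j, j != s i -> (rank (s i) <= rank j)%N -> A i j = 0) ->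
  \det A = (-1) ^+ s * \prod_i A i (s i).
Proof.
move=> A0; rewrite /determinant (bigD1 s) //= [X in _ + X]big1 ?addr0 // => t nts.
suff [i Ai0] : exists i, A i (t i) = 0 by rewrite (bigD1 i) //= Ai0 mul0r mulr0.
have [/existsP[i /eqP]|] := boolP [exists i, A i (t i) == 0]; first by exists i.
rewrite negb_exists => /forallP Atn0.
have le_ts i : (rank (t i) <= rank (s i) ?= iff (t i == s i))%N.
  have [->|nti] := eqVneq (t i) (s i); first exact/leqif_refl.
  have lt_ts : (rank (t i) < rank (s i))%N.
    by rewrite ltnNge; apply: contra (Atn0 i) => le_st; rewrite A0.
  by split; [exact: ltnW | rewrite ltn_eqF].
have /eqP : (\sum_i rank (t i) = \sum_i rank (s i))%N.
  have sum_perm (u : 'S_n) : (\sum_i rank (u i) = \sum_i rank i)%N.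
    by rewrite [RHS](reindex_inj (@perm_inj _ u)).
  by rewrite !sum_perm.
rewrite (leqif_sum (fun i _ => le_ts i)) => /forallP ts.
by case/eqP: nts; apply/permP => i; apply/eqP/ts.
Qed.

(** The operations multiply A on the left by a matrix that is triangular for
    [rank], with the al i on its diagonal. *)
Lemma det_row_reduction A (al be : 'I_n -> R) (tau : 'I_n -> 'I_n) rank :
  (forall i, be i = 0 \/ (rank (tau i) < rank i)%N) ->
  \det (\matrix_(i, j) (al i * A i j + be i * A (tau i) j))
  = (\prod_i al i) * \det A.
Proof.
move=> be0.
pose E : 'M[R]_n := \matrix_(i, j) (al i * (j == i)%:R + be i * (j == tau i)%:R).
have -> : \matrix_(i, j) (al i * A i j + be i * A (tau i) j) = E *m A.
  apply/matrixP => i j; rewrite !mxE.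
  have pick q : \sum_k (k == q)%:R * A k j = A q j.
    rewrite (bigD1 q) //= eqxx mul1r big1 ?addr0 // => k /negPf->.
    by rewrite mul0r.
  under eq_bigr => k _ do rewrite mxE mulrDl -!mulrA.
  by rewrite big_split /= -!mulr_sumr !pick.
rewrite det_mulmx; congr (_ * _).
rewrite (@det_perm_trig E 1%g rank) => [|i j]; last first.
  rewrite perm1 mxE => /negPf-> le_ij; rewrite mulr0 add0r.
  case: (be0 i) => [->|lt_i]; first by rewrite mul0r.
  by case: eqP => [eq_j|_]; [rewrite leqNgt eq_j lt_i in le_ij | rewrite mulr0].
rewrite odd_perm1 expr0 mul1r; apply: eq_bigr => i _.
rewrite perm1 mxE eqxx mulr1; case: (be0 i) => [->|]; first by rewrite mul0r addr0.
by case: eqP => [<-|_]; rewrite ?ltnn ?mulr0 ?addr0.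
Qed.
End PermTrig.

(** * The determinant of Nanson's matrix *)

Section NansonDet.
Variables (R : idomainType) (a b c d e f g h : R).

(** The leading 16 x 16 block becomes triangular along the permutation
    [half_turn], which exchanges 2 m and 2 m + 1.  Writing it as the square of
    this permutation makes its sign evident. *)
Definition quarter_turn (i : nat) : nat :=
  nth 0%N [:: 2; 3; 1; 0; 6; 7; 5; 4; 10; 11; 9; 8; 14; 15; 13; 12] i.

Lemma quarter_turn_lt (i : 'I_16) : (quarter_turn i < 16)%N.
Proof. by case: i; do 16![case=> [|] //]. Qed.

Lemma quarter_turn_inj : injective (fun i => Ordinal (quarter_turn_lt i)).
Proof.
move=> i j /(congr1 val) /eqP; rewrite nth_uniq ?ltn_ord // => /eqP.
exact: val_inj.
Qed.

Definition half_turn : 'S_16 := (perm quarter_turn_inj ^+ 2)%g.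

Lemma half_turnE (i : 'I_16) :
  half_turn i = quarter_turn (quarter_turn i) :> nat.
Proof. by rewrite /half_turn expgS expg1 permM !permE. Qed.

Lemma half_turn_even : half_turn = false :> bool.
Proof. by rewrite /half_turn expgS expg1 odd_permM addbb. Qed.

(** Row operations make the block triangular.  They scale two rows by g and two
    rows by h, whence the factor g^2 h^2 that is cancelled in the end. *)
Lemma det_nanson_top : g != 0 -> h != 0 ->
  \det (mxtab 16 16 (nanson_top a b c d e f g h))
  = 9 * (e ^+ 2 * f ^+ 2 * g ^+ 2 * h ^+ 2)
    * ((a * c - e * g) * (a * d - f * g) * (b * c - e * h) * (b * d - f * h)).
Proof.
move=> g0 h0; pose t i j := (nth [::] (nanson_top a b c d e f g h) i)`_j.
(* Row i becomes al i times itself plus be i times row tau i.  Each of these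
   operations clears an entry that the order given by rank forbids. *)
pose al i : R := [:: 1; 1; 1; 1; 1; 1; 1; 1; g; g; 1; 1; h; h; 1; 1]`_i.
pose be i : R := [:: -2; 0; 0; 0; 0; 0; 0; 0; -a; -a; -2; 0; -b; -b; 0; 0]`_i.
pose tau i :=
  nth 0%N [:: 5; 0; 0; 0; 0; 0; 0; 0; 7; 3; 15; 0; 6; 2; 0; 0] i.
have tau_lt i : (tau i < 16)%N.
  by rewrite /tau; do 16![case: i => [|i] //]; rewrite /= nth_nil.
(* Rows that change are combined with rows that do not. *)
pose changed i :=
  nth 0%N [:: 1; 0; 0; 0; 0; 0; 0; 0; 1; 1; 1; 0; 1; 1; 0; 0] i.
have red := @det_row_reduction R 16
  (mxtab 16 16 (nanson_top a b c d e f g h)) al be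
  (fun i => Ordinal (tau_lt i)) changed.
have gh0 : g ^+ 2 * h ^+ 2 != 0 by rewrite mulf_neq0 ?expf_neq0.
apply: (mulfI gh0).
have al_prod : \prod_(i < 16) al i = g ^+ 2 * h ^+ 2.
  by rewrite !big_ord_recl big_ord0 /al /=; ring.
rewrite -{1}al_prod -red => [|i]; last first.
  case: i => i i16; rewrite /be /changed /=.
  by do 16![case: i i16 => [|i] i16; first by [left | right]].
pose rank j :=
  nth 0%N [:: 12; 0; 9; 11; 1; 13; 5; 7; 8; 4; 14; 2; 10; 6; 3; 15] j.
rewrite (@det_perm_trig _ _ _ half_turn rank) => [|i j nij]; last first.
  rewrite !half_turnE mxE.
  have {nij} : j != quarter_turn (quarter_turn i) :> nat by rewrite -half_turnE.
  rewrite /mxtab !mxE.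
  case: i => i i16; case: j => j j16; rewrite /al /be /t /tau /rank /quarter_turn.
  do 16![case: i i16 => [|i] i16; first by
    do 16![case: j j16 => [|j] j16; first by move=> //= _ //= _; ring]].
  by [].
rewrite half_turn_even expr0 mul1r.
under eq_bigr => i _ do rewrite !mxE half_turnE.
rewrite !big_ord_recl big_ord0 /= /t /al /be /tau /=.
ring.
Qed.

Lemma det_nanson_schur :
  \det (mxtab 4 4 (nanson_schur a b c d e f g h))
  = - 27 * ((a * c - e * g) * (a * d - f * g) * (b * c - e * h) * (b * d - f * h))
      * delta a b c d e f g h.
Proof.
rewrite (det_mx44 (fun i j => (nth [::] (nanson_schur a b c d e f g h) i)`_j)).
by rewrite /det4 /delta /=; ring.
Qed.
End NansonDet.

(** The factors add up to 16^4 * 9 * 27 = 2^16 * 3^5, and the sign of the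
    discriminant absorbs that of -27. *)
Lemma cubic_discriminant_cubic (R : idomainType) (a b c d e f g h : R) :
  g != 0 -> h != 0 ->
  cubic_discriminant (cubic a%:MP b%:MP c%:MP d%:MP e%:MP f%:MP g%:MP h%:MP
                        'X_0 'X_1 'X_2 'X_3)
  = 2 ^+ 16 * 3 ^+ 5 * (e ^+ 2 * f ^+ 2 * g ^+ 2 * h ^+ 2)
    * (a * c - e * g) ^+ 2 * (a * d - f * g) ^+ 2
    * (b * c - e * h) ^+ 2 * (b * d - f * h) ^+ 2 * delta a b c d e f g h.
Proof.
move=> g0 h0; rewrite /cubic_discriminant.
set Q := fun j : 'I_4 => _.
have -> : \det (nanson_mx Q) = \det (nanson_mx Q : 'M_(16 + 4)) by [].
rewrite nanson_mx_cubic.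
set T := mxtab 16 (16 + 4) _; set C := 4 *: _; set S := 16 *: _.
have -> : col_mx T (C *m T + row_mx 0 S)
    = block_mx 1%:M 0 C 1%:M *m block_mx (lsubmx T) (rsubmx T) 0 S.
  by rewrite !block_mxEv !hsubmxK mul_col_mx !mul_row_col !mul1mx mul0mx addr0.
rewrite det_mulmx det_lblock det_ublock !det1 !mul1r detZ det_nanson_schur.
have -> : lsubmx T = mxtab 16 16 (nanson_top a b c d e f g h).
  by apply/matrixP => i j; rewrite !mxE.
rewrite det_nanson_top //; ring.
Qed.

(** * Multivariate polynomials as polynomials in one variable *)

Lemma rmorph_mmap n (R : nzRingType) (S T : comNzRingType) (u : {rmorphism S -> T})
    (f : R -> S) (v : 'I_n -> S) (p : {mpoly R[n]}) :
  u (mmap f v p) = mmap (u \o f) (u \o v) p.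
Proof.
rewrite /mmap rmorph_sum; apply: eq_bigr => m _.
rewrite rmorphM /mmap1 rmorph_prod; congr (_ * _).
by apply: eq_bigr => i _; rewrite rmorphXn.
Qed.

Lemma eq_mmap n (R S : nzRingType) (f f' : R -> S) (v v' : 'I_n -> S)
    (p : {mpoly R[n]}) :
  f =1 f' -> v =1 v' -> mmap f v p = mmap f' v' p.
Proof.
by move=> eqf eqv; apply: eq_bigr => m _; rewrite eqf (mmap1_eq _ eqv).
Qed.

Lemma mmap_polyC_id n (R : nzRingType) (p : {mpoly R[n]}) :
  mmap (@mpolyC n R) (fun i => 'X_i) p = p.
Proof.
rewrite [RHS]mpolyE; apply: eq_bigr => m _.
by rewrite mmap1_id mul_mpolyC.
Qed.

Section Slice.
Variables (n : nat) (R : comNzRingType).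
Implicit Types (i j : 'I_n) (p q : {mpoly R[n]}).

(** The coefficients remain in the full ring of polynomials, although X_i does
    not occur in them, so that the number of variables stays the same. *)
Definition slice i : {mpoly R[n]} -> {poly {mpoly R[n]}} :=
  mmap (polyC \o @mpolyC n R) (fun j => if j == i then 'X else ('X_j)%:P).
HB.instance Definition _ i := GRing.RMorphism.on (slice i).

Lemma sliceX i j : slice i 'X_j = if j == i then 'X else ('X_j)%:P.
Proof. by rewrite /slice mmapX mmap1U. Qed.

Lemma sliceM i p q : slice i (p * q) = slice i p * slice i q.
Proof. exact: rmorphM. Qed.

Definition update (S : Type) (v : 'I_n -> S) i (r : S) : 'I_n -> S :=
  fun j => if j == i then r else v j.

Lemma horner_slice (S : comNzRingType) (f : {rmorphism R -> S}) (v : 'I_n -> S)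
    i (r : S) p :
  (map_poly (mmap f v) (slice i p)).[r] = mmap f (update v i r) p.
Proof.
rewrite -[LHS]/(horner_eval r _).
rewrite /slice (rmorph_mmap (map_poly (mmap f v))) (rmorph_mmap (horner_eval r)).
apply: eq_mmap => [c|j] /=; rewrite /horner_eval.
  by rewrite map_polyC hornerC; apply: mmapC.
rewrite /update; case: eqP => _; first by rewrite map_polyX hornerX.
by rewrite map_polyC hornerC /= mmapX mmap1U.
Qed.

Lemma meval_slice (v : 'I_n -> R) i (r : R) p :
  (map_poly (meval v) (slice i p)).[r] = p.@[update v i r].
Proof. exact: horner_slice. Qed.

Lemma horner_sliceX i p : (slice i p).['X_i] = p.
Proof.
rewrite -[LHS]/(horner_eval _ _) /slice (rmorph_mmap (horner_eval 'X_i)).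
rewrite -[RHS]mmap_polyC_id; apply: eq_mmap => [c|j] /=; rewrite /horner_eval.
  by rewrite hornerC.
by case: eqP => [->|_]; rewrite ?hornerX ?hornerC.
Qed.

Lemma slice_inj i : injective (slice i).
Proof. by move=> p q eq_pq; rewrite -[p](horner_sliceX i) eq_pq horner_sliceX. Qed.

End Slice.

Lemma poly_infinite_roots (D : idomainType) (q : {poly D}) (r : nat -> D) :
  injective r -> (forall k, root q (r k)) -> q = 0.
Proof.
move=> inj_r q0; apply/eqP; apply: contraT => nz_q.
have := max_poly_roots nz_q (rs := mkseq r (size q)).
rewrite size_mkseq ltnn; apply; last by rewrite mkseq_uniq.
by apply/allP => _ /mapP[k _ ->].
Qed.

(** Free the variables one at a time: if p vanishes whenever the first k
    variables are indeterminate and the others are constants, then, sliced along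
    the k-th variable, it has infinitely many roots. *)
Lemma mpoly_eval0 (C : numDomainType) n (p : {mpoly C[n]}) :
  (forall v, p.@[v] = 0) -> p = 0.
Proof.
move=> p0.
pose part k (v : 'I_n -> C) : 'I_n -> {mpoly C[n]} :=
  fun j => if (j < k)%N then 'X_j else (v j)%:MP.
suff part0 k v : (k <= n)%N -> mmap (@mpolyC n C) (part k v) p = 0.
  rewrite -[p]mmap_polyC_id -[RHS](part0 n (fun=> 0)) //.
  by apply: eq_mmap => // j; rewrite /part ltn_ord.
elim: k v => [|k IHk] v lt_kn.
  have /(congr1 (@mpolyC n C)) := p0 v; rewrite mpolyC0 => <-.
  by rewrite /meval rmorph_mmap; apply: eq_mmap.
pose i := Ordinal lt_kn; set q := mmap _ _ p.
apply: (@slice_inj _ _ i); rewrite rmorph0.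
apply: (@poly_infinite_roots _ _ (fun m => (m%:R)%:MP)) => [k1 k2 /eqP|m].
  by rewrite mpolyC_eq eqr_nat => /eqP.
have -> : slice i q = map_poly (mmap (@mpolyC n C) (fun i => 'X_i)) (slice i q).
  by rewrite map_poly_id // => c _; apply: mmap_polyC_id.
rewrite /root horner_slice /q rmorph_mmap.
rewrite -[X in X == 0]/(mmap _ _ p) -(IHk (update v i m%:R)) 1?ltnW //.
apply/eqP/eq_mmap => [c|j] /=; first exact: mmapC.
rewrite /part /update ltnS leq_eqVlt -[j == k :> nat]/(j == i).
case: eqVneq => [->|/negPf nji] /=; first by rewrite ltnn mmapX mmap1U eqxx.
case: ltnP => _ /=; last exact: mmapC.
by rewrite mmapX mmap1U nji.
Qed.

(** X_i is prime, and v is a point of the hyperplane X_i = 0 at which D does not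
    vanish, so X_i does not divide D and each factor X_i divides Q. *)
Lemma mpoly_dvd_mulX (R : idomainType) n (i : 'I_n) (P Q D : {mpoly R[n]}) k v :
  v i = 0 -> D.@[v] != 0 -> 'X_i ^+ k * P = Q * D ->
  exists Q', P = Q' * D.
Proof.
move=> vi0 Dv; elim: k Q => [|k IHk] Q; first by rewrite mul1r; exists Q.
rewrite exprS -mulrA => eqXP.
have : (slice i Q * slice i D).[0] = 0.
  by rewrite -rmorphM -eqXP rmorphM /= sliceX eqxx hornerM hornerX mul0r.
rewrite hornerM => /eqP; rewrite mulf_eq0 => /orP[/factor_theorem[q]|/eqP D0].
  rewrite subr0 => /(congr1 (horner^~ 'X_i)); rewrite hornerM hornerX horner_sliceX.
  move=> defQ; apply: (IHk q.['X_i]); apply: (mulfI (mpolyXU_neq0 R i)).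
  by rewrite eqXP defQ mulrAC mulrC.
case/eqP: Dv.
have := congr1 (meval v) D0; rewrite meval0 => <-.
rewrite -[in RHS]horner_map /= meval0 meval_slice.
by apply: meval_eq => j; rewrite /update; case: eqP => [->|].
Qed.

(** * Zeros of Delta and singular points in the torus *)

(** As a cubic in h, constant term first. *)
Definition delta_coefs (R : comNzRingType) (a b c d e f g : R) : seq R :=
  [:: a^+2*b^+4*g^+2 - 2*a^+2*b^+3*c*d*g + a^+2*b^+2*c^+2*d^+2 -
      2*a*b^+3*c*f*g^+2 - 2*a*b^+3*d*e*g^+2 + 4*a*b^+2*c^+2*d*f*g +
      4*a*b^+2*c*d^+2*e*g - 2*a*b*c^+3*d^+2*f - 2*a*b*c^+2*d^+3*e +
      4*b^+3*e*f*g^+3 + b^+2*c^+2*f^+2*g^+2 - 10*b^+2*c*d*e*f*g^+2 +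
      b^+2*d^+2*e^+2*g^+2 - 2*b*c^+3*d*f^+2*g + 8*b*c^+2*d^+2*e*f*g -
      2*b*c*d^+3*e^+2*g + c^+4*d^+2*f^+2 - 2*c^+3*d^+3*e*f + c^+2*d^+4*e^+2;
      - 2*a^+3*b^+3*g - 2*a^+3*b^+2*c*d + 8*a^+2*b^+2*c*f*g +
      8*a^+2*b^+2*d*e*g + 4*a^+2*b*c^+2*d*f + 4*a^+2*b*c*d^+2*e -
      6*a*b^+2*e*f*g^+2 - 10*a*b*c^+2*f^+2*g - 26*a*b*c*d*e*f*g -
      10*a*b*d^+2*e^+2*g - 2*a*c^+3*d*f^+2 + 8*a*c^+2*d^+2*e*f -
      2*a*c*d^+3*e^+2 + 18*b*c*e*f^+2*g^+2 + 18*b*d*e^+2*f*g^+2 +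
      4*c^+3*f^+3*g - 6*c^+2*d*e*f^+2*g - 6*c*d^+2*e^+2*f*g + 4*d^+3*e^+3*g;
      a^+4*b^+2 - 2*a^+3*b*c*f - 2*a^+3*b*d*e - 6*a^+2*b*e*f*g +
      a^+2*c^+2*f^+2 - 10*a^+2*c*d*e*f + a^+2*d^+2*e^+2 + 18*a*c*e*f^+2*g +
      18*a*d*e^+2*f*g - 27*e^+2*f^+2*g^+2;
      4*a^+3*e*f].

Lemma horner_delta_coefs (R : comNzRingType) (a b c d e f g h : R) :
  (Poly (delta_coefs a b c d e f g)).[h] = delta a b c d e f g h.
Proof. by rewrite horner_Poly /delta /delta_coefs /=; ring. Qed.

Lemma rmorph_delta (R S : comNzRingType) (u : {rmorphism R -> S}) a b c d e f g h :
  u (delta a b c d e f g h)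
  = delta (u a) (u b) (u c) (u d) (u e) (u f) (u g) (u h).
Proof. by rewrite /delta; ring. Qed.

Lemma map_delta_coefs (R S : comNzRingType) (u : {rmorphism R -> S}) a b c d e f g :
  map u (delta_coefs a b c d e f g)
  = delta_coefs (u a) (u b) (u c) (u d) (u e) (u f) (u g).
Proof. by rewrite /delta_coefs /=; congr [:: _; _; _; _]; ring. Qed.

Lemma cubic_split (F : closedFieldType) (l m n k : F) : l != 0 ->
  exists r1 r2 r3, [/\ m = - l * (r1 + r2 + r3),
    n = l * (r1 * r2 + r1 * r3 + r2 * r3) & k = - l * (r1 * r2 * r3)].
Proof.
move=> l0; pose p := Poly [:: k; n; m; l].
have size_p : size p = 4 by rewrite (@PolyK _ 0) //=.
have lead_p : lead_coef p = l by rewrite lead_coefE size_p coef_Poly.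
have [rs defp] := closed_field_poly_normal p.
rewrite lead_p in defp.
have : size rs = 3.
  have := congr1 (fun q : {poly F} => size q) defp.
  by rewrite size_p size_scale // size_prod_XsubC => -[].
case: rs defp => [|r1 [|r2 [|r3 []]]] // + _.
rewrite !big_cons big_nil mulr1 => defp.
exists r1, r2, r3.
have {}defp : p = Poly [:: - l * (r1 * r2 * r3); l * (r1 * r2 + r1 * r3 + r2 * r3);
    - l * (r1 + r2 + r3); l].
  rewrite defp /= !cons_poly_def -mul_polyC; ring.
split; [have := congr1 (coefp 2) defp | have := congr1 (coefp 1) defp
  | have := congr1 (coefp 0) defp]; by rewrite /coefp !coef_Poly.
Qed.

Lemma disc3_split (R : comNzRingType) (l r1 r2 r3 : R) :
  disc3 l (- l * (r1 + r2 + r3)) (l * (r1 * r2 + r1 * r3 + r2 * r3))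
    (- l * (r1 * r2 * r3))
  = l ^+ 4 * ((r1 - r2) * (r1 - r3) * (r2 - r3)) ^+ 2.
Proof. by rewrite /disc3; ring. Qed.

Lemma disc3_double_root (F : closedFieldType) (l m n k : F) :
  l != 0 -> disc3 l m n k = 0 ->
  exists2 r, l * r ^+ 3 + m * r ^+ 2 + n * r + k = 0
    & 3 * l * r ^+ 2 + 2 * m * r + n = 0.
Proof.
move=> l0; have [r1 [r2 [r3 [-> -> ->]]]] := cubic_split m n k l0.
rewrite disc3_split => /eqP.
rewrite mulf_eq0 !expf_eq0 (negPf l0) /= !mulf_eq0 !subr_eq0 -!orbA.
by case/or3P => /eqP->; [exists r2 | exists r3 | exists r3]; ring.
Qed.

(** At the point (s, 1, t lam, lam), the cubic form is
      e s^2 + lam K s t + g lam^3 t^2 + U s + lam^2 V t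
    with U, V, K as below: a conic in (s, t) through the origin.  Twice its
    symmetric matrix has determinant 2 lam^3 D(lam), where
    D = K U V - e lam V^2 - g U^2.  At a root of D the conic has a singular
    point (s, t).  At a double root the derivative of the form along lam
    vanishes there too: the derivative of the determinant is that of the matrix
    paired with the adjugate, which for a symmetric matrix of rank 2 is a
    multiple of the square of the kernel vector.  The conditions on the
    coefficients keep lam, U, V, E away from zero, hence s and t finite and
    nonzero. *)
Lemma singular_torus_point (F : closedFieldType) (a b c d e f g h : F) :
  2 != 0 :> F -> c != 0 -> e != 0 -> f != 0 -> g != 0 -> h != 0 ->
  a * c - e * g != 0 -> a * d - f * g != 0 ->
  b * c - e * h != 0 -> b * d - f * h != 0 ->
  delta a b c d e f g h = 0 ->
  exists x y z w, [/\ x != 0, y != 0, z != 0, w != 0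
    & partials a b c d e f g h x y z w = [:: 0; 0; 0; 0]].
Proof.
move=> two0 c0 e0 f0 g0 h0 ac ad bc bd delta0.
have lead0 : b * c * h - e * h ^+ 2 != 0.
  by rewrite expr2 mulrA -mulrBl mulf_neq0.
have := disc3_conic_pencil a b c d e f g h; rewrite delta0 mulr0.
case/(disc3_double_root lead0) => lam D0 D'0.
pose U := f + b * lam; pose V := d + h * lam; pose K := a + c * lam.
have {}D0 : K * U * V - e * lam * V ^+ 2 - g * U ^+ 2 = 0.
  by rewrite -[RHS]D0 /K /U /V; ring.
have {}D'0 : c * U * V + b * K * V + h * K * U - e * V ^+ 2
    - 2 * e * h * lam * V - 2 * b * g * U = 0.
  by rewrite -[RHS]D'0 /K /U /V; ring.
have lam0 : lam != 0.
  apply/eqP => lam0; case/negP: (mulf_neq0 f0 ad); apply/eqP.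
  by rewrite -[RHS]D0 /K /U /V lam0; ring.
have UV0 : U = 0 -> V = 0 -> False.
  move=> U0 V0; case/eqP: bd.
  transitivity (b * V - h * U); first by rewrite /U /V; ring.
  by rewrite U0 V0; ring.
have U0 : U != 0.
  apply/eqP => U0; apply: (UV0 U0); apply/eqP.
  have : e * lam * V ^+ 2 == 0.
    by rewrite -oppr_eq0 -[X in _ == X]D0 U0; apply/eqP; ring.
  by rewrite !mulf_eq0 (negPf e0) (negPf lam0) /= orbb.
have V0 : V != 0.
  apply/eqP => V0; apply: (UV0 _ V0); apply/eqP.
  have : g * U ^+ 2 == 0.
    by rewrite -oppr_eq0 -[X in _ == X]D0 V0; apply/eqP; ring.
  by rewrite !mulf_eq0 (negPf g0) /= orbb.
pose E := K * U - 2 * e * lam * V.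
have E0 : E != 0.
  apply/eqP => E0.
  (* If E = 0, then the equations of the double root force c U = e V and
     a = c lam, whence a c = e g. *)
  have KU : K * U = 2 * e * lam * V by apply/eqP; rewrite -subr_eq0 -/E E0.
  have gUU : g * U ^+ 2 = e * lam * V ^+ 2.
    by apply/eqP; rewrite eq_sym -subr_eq0 -[X in _ == X]D0 KU; apply/eqP; ring.
  have cU : c * U = e * V.
    apply: (mulfI (mulf_neq0 U0 V0)); apply/eqP; rewrite -subr_eq0; apply/eqP.
    transitivity (U * 0); last exact: mulr0.
    rewrite -[X in U * X]D'0.
    transitivity (c * U ^+ 2 * V - e * U * V ^+ 2 + b * V * (K * U) + h * U * (K * U)
      - 2 * e * h * lam * V * U - 2 * b * (g * U ^+ 2)); last by ring.
    by rewrite KU gUU; ring.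
  have a_clam : a = c * lam.
    apply: (mulIf U0); apply/eqP; rewrite -subr_eq0; apply/eqP.
    transitivity (K * U - 2 * lam * (c * U)); first by rewrite /K; ring.
    by rewrite KU cU; ring.
  have four_lamUU0 : 2 * (2 * (lam * U ^+ 2)) != 0.
    by rewrite !mulf_neq0 ?expf_neq0.
  case/eqP: ac; apply: (mulIf four_lamUU0).
  transitivity ((K * U) ^+ 2 - 4 * e * lam * (g * U ^+ 2)).
    by rewrite /K a_clam; ring.
  by rewrite KU gUU; ring.
(* The kernel of the matrix of the conic is spanned by the vector
   (- U V lam^2, U^2, - lam E), as its last and first row show; scaling its last
   coordinate to 1 gives (s, t). *)
pose m := - U / (lam * E).
have m0 : m != 0 by rewrite mulf_neq0 ?oppr_eq0 ?invr_eq0 ?mulf_neq0.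
pose s := - (V * lam ^+ 2 * m); pose t := U * m.
have mE : m * (lam * E) = - U by rewrite divfK ?mulf_neq0.
(* The three rows of the matrix of the conic at (s, t, 1), the second one
   divided by lam. *)
have row1 : 2 * e * s + lam * K * t + U = 0.
  transitivity (m * (lam * E) + U); first by rewrite /s /t /E; ring.
  by rewrite mE; ring.
have row2 : K * s + lam * V + 2 * g * lam ^+ 2 * t = 0.
  apply: (mulfI E0); rewrite mulr0.
  transitivity (m * (lam * E) * (lam * (2 * g * U - K * V)) + lam * V * E).
    by rewrite /s /t; ring.
  rewrite mE /E.
  transitivity (2 * lam * (K * U * V - e * lam * V ^+ 2 - g * U ^+ 2)).
    by ring.
  by rewrite D0; ring.
have row3 : U * s + lam ^+ 2 * V * t = 0 by rewrite /s /t; ring.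
(* The derivative of the form with respect to lam, for s and t fixed. *)
have slope : s * (a * t + b) + 2 * t * (c * s + d) * lam
    + 3 * t * (g * t + h) * lam ^+ 2 = 0.
  apply: (mulfI U0); rewrite mulr0.
  pose A2 := 3 * g * U ^+ 2 * lam ^+ 2 - a * U * V * lam ^+ 2
    - 2 * c * U * V * lam ^+ 3.
  pose A1 := 2 * d * U * lam + 3 * h * U * lam ^+ 2 - b * V * lam ^+ 2.
  transitivity (m ^+ 2 * (U * A2 - lam * E * A1) + m * A1 * (m * (lam * E) + U)).
    by rewrite /s /t /A1 /A2; ring.
  rewrite mE addNr mulr0 addr0; apply/eqP; rewrite mulf_eq0; apply/orP; right.
  apply/eqP.
  transitivity (2 * b * lam ^+ 3 * (K * U * V - e * lam * V ^+ 2 - g * U ^+ 2)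
     - U * lam ^+ 3 * (c * U * V + b * K * V + h * K * U - e * V ^+ 2
         - 2 * e * h * lam * V - 2 * b * g * U)
     - 3 * U * lam ^+ 2 * (K * U * V - e * lam * V ^+ 2 - g * U ^+ 2)).
    by rewrite /A1 /A2 /E /K /U /V; ring.
  by rewrite D0 D'0; ring.
have s0 : s != 0.
  by rewrite oppr_eq0 (mulf_neq0 (mulf_neq0 V0 (expf_neq0 2 lam0)) m0).
have t0 : t != 0 := mulf_neq0 U0 m0.
exists s, 1, (t * lam), lam.
split; [exact: s0 | exact: oner_neq0 | exact: mulf_neq0 | exact: lam0 |].
(* The partial derivatives along x, z and w at (s, 1, t lam, lam); the one
   along y is then half a combination of these and of the three rows. *)
have P0 : 2 * e * s * 1 + f * 1 ^+ 2 + a * 1 * (t * lam) + b * 1 * lam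
    + c * (t * lam) * lam = 0.
  by rewrite -[RHS]row1 /K /U; ring.
have P2 : a * s * 1 + c * s * lam + d * 1 * lam + 2 * g * (t * lam) * lam
    + h * lam ^+ 2 = 0.
  by rewrite -[RHS]row2 /K /V; ring.
have P3 : b * s * 1 + c * s * (t * lam) + d * 1 * (t * lam)
    + g * (t * lam) ^+ 2 + 2 * h * (t * lam) * lam = 0.
  transitivity (s * (a * t + b) + 2 * t * (c * s + d) * lam
      + 3 * t * (g * t + h) * lam ^+ 2 - t * (a * s * 1 + c * s * lam
      + d * 1 * lam + 2 * g * (t * lam) * lam + h * lam ^+ 2)); first by ring.
  by rewrite slope P2; ring.
rewrite /partials P0 P2 P3; congr [:: _; _; _; _].
apply: (mulfI two0); rewrite mulr0.
transitivity (s * (2 * e * s + lam * K * t + U)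
   + t * lam * (K * s + lam * V + 2 * g * lam ^+ 2 * t)
   + 3 * (U * s + lam ^+ 2 * V * t)
   - 2 * lam * (b * s * 1 + c * s * (t * lam) + d * 1 * (t * lam)
                + g * (t * lam) ^+ 2 + 2 * h * (t * lam) * lam)).
  by rewrite /K /U /V; ring.
by rewrite row1 row2 row3 P3; ring.
Qed.

(** Delta is homogeneous for the grading by exponent vectors, so rescaling the
    variables of the cubic only multiplies it by a monomial. *)
Lemma delta_torus (R : comNzRingType) (a b c d e f g h x y z w : R) :
  delta (a * (x * y * z)) (b * (x * y * w)) (c * (x * z * w)) (d * (y * z * w))
    (e * (x ^+ 2 * y)) (f * (x * y ^+ 2)) (g * (z ^+ 2 * w)) (h * (z * w ^+ 2))
  = (x * y * z * w) ^+ 6 * delta a b c d e f g h.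
Proof. by rewrite /delta; ring. Qed.

(** Where 3 is not a zero divisor, these are the solutions of the four linear
    equations in the coefficients which say that the cubic is singular at
    (1, 1, 1, 1). *)
Lemma delta_kernel (R : comNzRingType) (e f g h : R) :
  let b := g - e - f in let a := b - g + h in
  let d := - 2 * b + g - h - e - 2 * f in let c := d - e + f in
  delta a b c d e f g h = 0.
Proof. by cbv zeta; rewrite /delta; ring. Qed.

(** Multiplied by the variable, each partial derivative is a linear form in the
    values A, ..., I of the eight terms at the singular point. *)
Lemma singular_delta (F : idomainType) (a b c d e f g h x y z w : F) :
  3 != 0 :> F -> x != 0 -> y != 0 -> z != 0 -> w != 0 ->
  partials a b c d e f g h x y z w = [:: 0; 0; 0; 0] ->
  delta a b c d e f g h = 0.
Proof.
move=> three0 x0 y0 z0 w0 [Px Py Pz Pw].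
apply: (mulfI (expf_neq0 6 (mulf_neq0 (mulf_neq0 (mulf_neq0 x0 y0) z0) w0))).
rewrite mulr0 -delta_torus.
set A := a * _; set B := b * _; set C := c * _; set D := d * _.
set E := e * _; set G := f * _; set H := g * _; set I := h * _.
have Ex : A + B + C + 2 * E + G = 0.
  by rewrite -[RHS](mulr0 x) -[X in x * X]Px /A /B /C /E /G; ring.
have Ey : A + B + D + E + 2 * G = 0.
  by rewrite -[RHS](mulr0 y) -[X in y * X]Py /A /B /D /E /G; ring.
have Ez : A + C + D + 2 * H + I = 0.
  by rewrite -[RHS](mulr0 z) -[X in z * X]Pz /A /C /D /H /I; ring.
have Ew : B + C + D + H + 2 * I = 0.
  by rewrite -[RHS](mulr0 w) -[X in w * X]Pw /B /C /D /H /I; ring.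
have defA : A = B - H + I.
  apply/eqP; rewrite -subr_eq0 -[X in _ == X](subrr 0) -{1}Ez -Ew; apply/eqP; ring.
have defC : C = D - E + G.
  apply/eqP; rewrite -subr_eq0 -[X in _ == X](subrr 0) -{1}Ex -Ey; apply/eqP; ring.
have defD : D = - 2 * B + H - I - E - 2 * G.
  by apply/eqP; rewrite -subr_eq0 -[X in _ == X]Ey defA; apply/eqP; ring.
have defB : B = H - E - G.
  apply: (mulfI three0); apply/eqP; rewrite -subr_eq0; apply/eqP.
  transitivity (- (A + C + D + 2 * H + I)); last by rewrite Ez oppr0.
  by rewrite defA defC defD; ring.
by rewrite defA defC defD defB; apply: delta_kernel.
Qed.

Lemma euler_cubic (R : comNzRingType) (a b c d e f g h x y z w : R) :
  let P := partials a b c d e f g h x y z w in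
  3 * cubic a b c d e f g h x y z w = x * P`_0 + y * P`_1 + z * P`_2 + w * P`_3.
Proof. by rewrite /= /cubic; ring. Qed.

Section Singular.
Variable C : numClosedFieldType.
Implicit Type v : 'I_8 -> C.

Lemma sparse_poly_cubic v :
  sparse_poly eight_monomials v
  = cubic (v 0)%:MP (v 1)%:MP (v 2)%:MP (v 3)%:MP (v 4)%:MP (v 5)%:MP (v 6)%:MP
      (v 7)%:MP 'X_0 'X_1 'X_2 'X_3.
Proof.
have X4 (i j k l : nat) : 'X_[[multinom [tuple i; j; k; l]]]
    = 'X_0 ^+ i * 'X_1 ^+ j * 'X_2 ^+ k * 'X_3 ^+ l :> {mpoly C[4]}.
  by rewrite mpolyXE_id prod_ord4 !multinomE !(tnth_nth 0%N).
rewrite /sparse_poly !big_ord_recl big_ord0 /cubic !(tnth_nth 0%MM) /= !X4.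
rewrite !(expr0, expr1, mulr1, mul1r) addr0 !addrA -!mul_mpolyC.
by do 7?congr (_ + _); congr ((v _)%:MP * _); apply: val_inj.
Qed.

Lemma singular_torus_pointP v :
  has_singular_torus_point eight_monomials v <->
  exists x y z w, [/\ x != 0, y != 0, z != 0, w != 0
    & partials (v 0) (v 1) (v 2) (v 3) (v 4) (v 5) (v 6) (v 7) x y z w
      = [:: 0; 0; 0; 0]].
Proof.
rewrite /has_singular_torus_point sparse_poly_cubic.
have derE (x : 'I_4 -> C) (j : 'I_4) :
  ((cubic (v 0)%:MP (v 1)%:MP (v 2)%:MP (v 3)%:MP (v 4)%:MP (v 5)%:MP
      (v 6)%:MP (v 7)%:MP 'X_0 'X_1 'X_2 'X_3)^`M(j)).@[x]
  = (partials (v 0) (v 1) (v 2) (v 3) (v 4) (v 5) (v 6) (v 7)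
       (x 0) (x 1) (x 2) (x 3))`_j.
  rewrite mderiv_cubic; move: j.
  by apply: forall_ord4;
    rewrite /= !(mevalD, mevalM, mevalC, mevalXU, rmorphXn, rmorph_nat).
split=> [[x [x0 _ dF]]|[x [y [z [w [x0 y0 z0 w0 P0]]]]]].
  exists (x 0), (x 1), (x 2), (x 3); split=> //.
  apply: (@eq_from_nth _ 0) => // i i4.
  by rewrite -(derE x (Ordinal i4)) dF; case: i i4 => [|[|[|[|i]]]].
pose p (j : 'I_4) := [:: x; y; z; w]`_j.
exists p; split; first by apply: forall_ord4.
  have three0 : 3 != 0 :> C by rewrite pnatr_eq0.
  apply: (mulfI three0); rewrite mulr0.
  have -> : (cubic (v 0)%:MP (v 1)%:MP (v 2)%:MP (v 3)%:MP (v 4)%:MP (v 5)%:MP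
      (v 6)%:MP (v 7)%:MP 'X_0 'X_1 'X_2 'X_3).@[p]
    = cubic (v 0) (v 1) (v 2) (v 3) (v 4) (v 5) (v 6) (v 7) x y z w.
    by rewrite /cubic !(mevalD, mevalM, mevalC, mevalXU, rmorphXn) /=.
  by rewrite euler_cubic P0 /= !mulr0 !addr0.
by move=> j; rewrite derE P0; move: j; apply: forall_ord4.
Qed.
End Singular.

(** * The zero locus of Delta as a closure *)

Section Degeneracy.
Variable R : comNzRingType.
Implicit Types a b c d e f g h u v : R.

(** Delta as a binary form in h = u/v, to evaluate it at fractions such as
    bc/e without division. *)
Definition delta_form a b c d e f g u v : R :=
  let q := delta_coefs a b c d e f g in
  q`_3 * u ^+ 3 + q`_2 * u ^+ 2 * v + q`_1 * u * v ^+ 2 + q`_0 * v ^+ 3.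

Definition delta_disc a b c d e f g : R :=
  let q := delta_coefs a b c d e f g in disc3 q`_3 q`_2 q`_1 q`_0.

(** The hypersurface to avoid for Delta to have three distinct roots in h, at
    each of which [singular_torus_point] applies.  A root h is nonzero because
    Delta does not vanish at h = 0, and differs from bc/e and bd/f for the same
    reason. *)
Definition degeneracy a b c d e f g : R :=
  a * c * e * f * g * (a * c - e * g) * (a * d - f * g)
  * delta_form a b c d e f g 0 1 * delta_form a b c d e f g (b * c) e
  * delta_form a b c d e f g (b * d) f * delta_disc a b c d e f g.

Lemma delta_formE a b c d e f g h v :
  delta_form a b c d e f g (v * h) v = v ^+ 3 * delta a b c d e f g h.
Proof. by rewrite /delta_form /delta /=; ring. Qed.

End Degeneracy.

Lemma rmorph_degeneracy (R S : comNzRingType) (u : {rmorphism R -> S})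
    a b c d e f g :
  u (degeneracy a b c d e f g)
  = degeneracy (u a) (u b) (u c) (u d) (u e) (u f) (u g).
Proof.
have coefE i : u (delta_coefs a b c d e f g)`_i
    = (delta_coefs (u a) (u b) (u c) (u d) (u e) (u f) (u g))`_i.
  rewrite -map_delta_coefs; have [i4|i4] := ltnP i 4; first by rewrite (nth_map 0).
  by rewrite !nth_default ?size_map // rmorph0.
have formE x y : u (delta_form a b c d e f g x y)
    = delta_form (u a) (u b) (u c) (u d) (u e) (u f) (u g) (u x) (u y).
  by rewrite /delta_form; cbv zeta; rewrite !(rmorphD, rmorphM, rmorphXn, coefE).
have discE : u (delta_disc a b c d e f g)
    = delta_disc (u a) (u b) (u c) (u d) (u e) (u f) (u g).
  have disc3E l m n k : u (disc3 l m n k) = disc3 (u l) (u m) (u n) (u k).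
    by rewrite /disc3; ring.
  by rewrite /delta_disc; cbv zeta; rewrite disc3E !coefE.
by rewrite /degeneracy !(formE, discE, rmorphM, rmorphB) rmorph0 rmorph1.
Qed.

(** At this point Delta is 4 h^3 - 68 h^2 + 76 h - 28 as a polynomial in h. *)
Lemma degeneracy_neq0 (C : numClosedFieldType) :
  degeneracy 1 1 1 1 1 1 (-1) != 0 :> C.
Proof.
have coefs : delta_coefs 1 1 1 1 1 1 (-1) = [:: - 28; 76; - 68; 4] :> seq C.
  by rewrite /delta_coefs; congr [:: _; _; _; _]; ring.
have form0 : delta_form 1 1 1 1 1 1 (-1) 0 1 = - 28 :> C.
  by rewrite /delta_form coefs /=; ring.
have form1 : delta_form 1 1 1 1 1 1 (-1) 1 1 = - 16 :> C.
  by rewrite /delta_form coefs /=; ring.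
have disc : delta_disc 1 1 1 1 1 1 (-1) = - (11 ^+ 3 * 2 ^+ 12) :> C.
  by rewrite /delta_disc coefs /disc3 /=; ring.
have two : 1 - 1 * -1 = 2 :> C by ring.
rewrite /degeneracy !mulr1 form0 form1 disc two.
by rewrite !(mulf_neq0, expf_neq0, oppr_eq0, oner_eq0, pnatr_eq0).
Qed.

Lemma generic_singular_torus_point (C : numClosedFieldType) (v : 'I_8 -> C) :
  degeneracy (v 0) (v 1) (v 2) (v 3) (v 4) (v 5) (v 6) != 0 ->
  delta (v 0) (v 1) (v 2) (v 3) (v 4) (v 5) (v 6) (v 7) = 0 ->
  has_singular_torus_point eight_monomials v.
Proof.
move=> nondeg delta0; apply/singular_torus_pointP.
move: (v 0) (v 1) (v 2) (v 3) (v 4) (v 5) (v 6) (v 7) nondeg delta0.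
move=> a b c d e f g h; rewrite /degeneracy !mulf_eq0 !negb_or -!andbA.
case/and5P=> _ c0 e0 f0 /and5P[g0 ac ad form0 /and3P[forme formf _]] delta0.
have form_root u w : u != w * h \/ delta_form a b c d e f g u w = 0.
  have [->|] := eqVneq u (w * h); last by left.
  by right; rewrite delta_formE delta0 mulr0.
apply: singular_torus_point => //; rewrite ?pnatr_eq0 //.
- by case: (form_root 0 1) => [|/eqP];
    [rewrite mul1r eq_sym | rewrite (negPf form0)].
- by case: (form_root (b * c) e) => [|/eqP];
    [rewrite subr_eq0 | rewrite (negPf forme)].
- by case: (form_root (b * d) f) => [|/eqP];
    [rewrite subr_eq0 | rewrite (negPf formf)].
Qed.

Lemma delta_polyX (R : comNzRingType) (a b c d e f g : R) :
  delta a%:P b%:P c%:P d%:P e%:P f%:P g%:P 'X = Poly (delta_coefs a b c d e f g).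
Proof. by rewrite /= !cons_poly_def /delta; ring. Qed.

Definition delta_mpoly (R : comNzRingType) : {mpoly R[8]} :=
  delta 'X_0 'X_1 'X_2 'X_3 'X_4 'X_5 'X_6 'X_7.

Lemma meval_delta_mpoly (R : comNzRingType) (v : 'I_8 -> R) :
  (delta_mpoly R).@[v] = delta (v 0) (v 1) (v 2) (v 3) (v 4) (v 5) (v 6) (v 7).
Proof. by rewrite /delta_mpoly rmorph_delta /= !mevalXU. Qed.

Lemma slice_delta_mpoly (R : comNzRingType) :
  slice 7 (delta_mpoly R) = Poly (delta_coefs 'X_0 'X_1 'X_2 'X_3 'X_4 'X_5 'X_6).
Proof.
by rewrite /delta_mpoly rmorph_delta /= !sliceX /= delta_polyX.
Qed.

Lemma lead_delta_coefs (R : idomainType) (a b c d e f g : R) :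
  4 != 0 :> R -> a != 0 -> e != 0 -> f != 0 ->
  size (Poly (delta_coefs a b c d e f g)) = 4%N
  /\ lead_coef (Poly (delta_coefs a b c d e f g)) = 4 * a ^+ 3 * e * f.
Proof.
move=> four0 a0 e0 f0.
have size_delta : size (Poly (delta_coefs a b c d e f g)) = 4%N.
  by rewrite (@PolyK _ 0) //= !mulf_neq0 ?expf_neq0.
by rewrite lead_coefE size_delta coef_Poly.
Qed.

Lemma mpoly_nat_neq0 (R : numDomainType) n k : k.+1%:R != 0 :> {mpoly R[n]}.
Proof. by rewrite -mpolyC_nat mpolyC_eq0 pnatr_eq0. Qed.

Lemma delta_mpoly_size_lead_h (R : numDomainType) :
  size (slice 7 (delta_mpoly R)) = 4%N
  /\ lead_coef (slice 7 (delta_mpoly R)) = 4 * 'X_0 ^+ 3 * 'X_4 * 'X_5.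
Proof.
rewrite slice_delta_mpoly.
by apply: lead_delta_coefs; rewrite ?mpolyXU_neq0 ?(mpoly_nat_neq0 _ 8 3).
Qed.

Lemma root_remainder (R S : comNzRingType) (u : {rmorphism R -> S}) l
    (p d q t : {poly R}) (r : S) :
  l *: p = q * d + t -> (map_poly u p).[r] = 0 -> (map_poly u d).[r] = 0 ->
  root (map_poly u t) r.
Proof.
move=> /(congr1 (fun p => (map_poly u p).[r])) + p0 d0.
rewrite -mul_polyC rmorphM rmorphD rmorphM /= hornerM hornerD hornerM p0 d0.
by rewrite !mulr0 add0r => /esym/eqP.
Qed.

Lemma slice_dvd (R : comNzRingType) n (i : 'I_n) l (p d : {mpoly R[n]}) q :
  l *: slice i p = q * slice i d -> l * p = q.['X_i] * d.
Proof.
move=> eq_slices; rewrite -(horner_sliceX i p) -(horner_sliceX i d).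
by rewrite -hornerZ -hornerM eq_slices.
Qed.

(** Pseudo-division by Delta in the variable h leaves a remainder of degree at
    most 2, which for generic a, ..., g vanishes at three values of h. *)
Lemma delta_dvd (C : numClosedFieldType) (P : {mpoly C[8]}) :
  (forall v, has_singular_torus_point eight_monomials v -> P.@[v] = 0) ->
  exists Q, P = Q * delta_mpoly C.
Proof.
move=> P0; pose lead : {mpoly C[8]} := 4 * 'X_0 ^+ 3 * 'X_4 * 'X_5.
pose D := slice 7 (delta_mpoly C).
have [sizeD leadD] : size D = 4%N /\ lead_coef D = lead.
  exact: delta_mpoly_size_lead_h.
pose rem := slice 7 P %% D.
have size_rem : (size rem <= 3)%N.
  have : (size rem < size D)%N by rewrite ltn_modp -size_poly_eq0 sizeD.
  by rewrite sizeD.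
have divE := Pdiv.Idomain.divp_eq (slice 7 P) D; rewrite leadD -/rem in divE.
have rem_root v r :
    degeneracy (v 0) (v 1) (v 2) (v 3) (v 4) (v 5) (v 6) != 0 ->
    delta (v 0) (v 1) (v 2) (v 3) (v 4) (v 5) (v 6) r = 0 ->
    root (map_poly (meval v) rem) r.
  move=> nondeg delta0.
  apply: (root_remainder divE).
    rewrite (meval_slice v 7 r P).
    by apply: P0; apply: generic_singular_torus_point.
  by rewrite (meval_slice v 7 r (delta_mpoly C)) meval_delta_mpoly.
(* Three distinct roots are too many for a polynomial of size at most 3. *)
have rem_eval0 v : degeneracy (v 0) (v 1) (v 2) (v 3) (v 4) (v 5) (v 6) != 0 ->
    map_poly (meval v) rem = 0.
  move=> nondeg; have := nondeg; rewrite !mulf_eq0 !negb_or -!andbA.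
  case/and5P=> a0 _ e0 f0 /and5P[_ _ _ _ /and3P[_ _]].
  have l0 : (delta_coefs (v 0) (v 1) (v 2) (v 3) (v 4) (v 5) (v 6))`_3 != 0.
    by rewrite !mulf_neq0 ?expf_neq0 ?pnatr_eq0.
  set q := delta_coefs _ _ _ _ _ _ _ in l0.
  have [r1 [r2 [r3 [q2E q1E q0E]]]] := cubic_split q`_2 q`_1 q`_0 l0.
  rewrite /delta_disc -/q q2E q1E q0E disc3_split => disc0.
  have q_root r : r \in [:: r1; r2; r3] ->
      delta (v 0) (v 1) (v 2) (v 3) (v 4) (v 5) (v 6) r = 0.
    move=> r_in; rewrite -horner_delta_coefs -/q.
    have -> : (Poly q).[r] = q`_3 * (r - r1) * (r - r2) * (r - r3).
      transitivity (q`_3 * r ^+ 3 + q`_2 * r ^+ 2 + q`_1 * r + q`_0).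
        by rewrite horner_Poly /q /delta_coefs /=; ring.
      by rewrite q2E q1E q0E; ring.
    by move: r_in; rewrite !inE => /or3P[] /eqP->; ring.
  apply/eqP; apply: contraT => nz_rem.
  have := max_poly_roots nz_rem (rs := [:: r1; r2; r3]).
  rewrite ltnNge (leq_trans (size_poly _ _)) //; apply.
    by apply/allP => r r_in; apply: rem_root => //; apply: q_root.
  rewrite /= !inE negb_or andbT.
  move: disc0; rewrite mulf_eq0 negb_or !expf_eq0 => /andP[_].
  by rewrite /= !mulf_eq0 !subr_eq0 !negb_or -!andbA.
have rem0 : rem = 0.
  apply/polyP => k; rewrite coef0.
  pose W : {mpoly C[8]} := degeneracy 'X_0 'X_1 'X_2 'X_3 'X_4 'X_5 'X_6.
  have evalW v : W.@[v] = degeneracy (v 0) (v 1) (v 2) (v 3) (v 4) (v 5) (v 6).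
    by rewrite /W rmorph_degeneracy /= !mevalXU.
  have W0 : W != 0.
    pose v0 (i : 'I_8) : C := [:: 1; 1; 1; 1; 1; 1; -1]`_i.
    apply: contraNneq (degeneracy_neq0 C) => /(congr1 (meval v0)).
    by rewrite evalW meval0 => <-.
  apply: (mulIf W0); rewrite mul0r; apply: mpoly_eval0 => v.
  rewrite mevalM evalW.
  have [->|nondeg] :=
    eqVneq (degeneracy (v 0) (v 1) (v 2) (v 3) (v 4) (v 5) (v 6)) 0.
    by rewrite mulr0.
  by rewrite -(coef_map (meval v)) rem_eval0 // coef0 mul0r.
have [k [q divP]] : exists k q, lead ^+ k * P = q * delta_mpoly C.
  rewrite rem0 addr0 in divE.
  exists (Pdiv.Idomain.scalp (slice 7 P) D), (slice 7 P %/ D).['X_7].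
  exact: slice_dvd divE.
(* Delta is 4 at v1, where a = 0, and 1 at v2, where e = f = 0. *)
pose v1 (i : 'I_8) : C := [:: 0; 1; 0; 0; 1; 1; 1; 0]`_i.
pose v2 (i : 'I_8) : C := [:: 1; 1; 0; 0; 0; 0; 1; 0]`_i.
have delta1 : (delta_mpoly C).@[v1] != 0.
  by rewrite meval_delta_mpoly /v1 /delta /= (_ : _ + _ = 4) ?pnatr_eq0 //; ring.
have delta2 : (delta_mpoly C).@[v2] != 0.
  by rewrite meval_delta_mpoly /v2 /delta /= (_ : _ + _ = 1) ?oner_eq0 //; ring.
rewrite /lead 3!exprMn -exprM -!mulrA mulrCA in divP.
have {q divP}[q divP] := @mpoly_dvd_mulX C 8 0 _ _ _ _ v1 erefl delta1 divP.
rewrite mulrCA in divP.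
have {q divP}[q divP] := @mpoly_dvd_mulX C 8 4 _ _ _ _ v2 erefl delta2 divP.
rewrite mulrCA in divP.
have {q divP}[q divP] := @mpoly_dvd_mulX C 8 5 _ _ _ _ v2 erefl delta2 divP.
exists ((4 ^- k)%:MP * q); rewrite -mulrA -divP mulrA.
have -> : 4 ^+ k = (4 ^+ k)%:MP :> {mpoly C[8]}.
  by rewrite rmorphXn /= mpolyC_nat.
by rewrite -mpolyCM mulVf ?mpolyC1 ?mul1r // expf_neq0 ?pnatr_eq0.
Qed.

Lemma zariski_closure_singular (C : numClosedFieldType) (v : 'I_8 -> C) :
  (map_mpoly (intr : int -> C) (delta_mpoly int)).@[v] = 0
  <-> zariski_closure (has_singular_torus_point eight_monomials) v.
Proof.
have -> : map_mpoly (intr : int -> C) (delta_mpoly int) = delta_mpoly C.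
  by rewrite /delta_mpoly rmorph_delta /= !map_mpolyX.
split=> [delta0 P /delta_dvd[Q ->]|]; first by rewrite mevalM delta0 mulr0.
apply=> u /singular_torus_pointP[x [y [z [w [x0 y0 z0 w0 P0]]]]].
rewrite meval_delta_mpoly; apply: singular_delta x0 y0 z0 w0 P0.
by rewrite pnatr_eq0.
Qed.

(** * Irreducibility of Delta over the integers *)

Lemma size_factor_leq1 (R : idomainType) (p q : {poly R}) :
  p != 0 -> q != 0 -> (size (p * q)%R <= 1)%N -> (size p <= 1)%N.
Proof.
move=> p0 q0; rewrite size_mul //.
have : (0 < size q)%N by rewrite size_poly_gt0.
case: (size q) => // l _.
by rewrite addnS; apply/leq_trans/leq_addr.
Qed.

(** The cubic is invariant under the exchange of z and w together with that of
    a and b and that of g and h. *)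
Lemma delta_swap (R : comNzRingType) (a b c d e f g h : R) :
  delta a b c d e f g h = delta b a c d e f h g.
Proof. by rewrite /delta; ring. Qed.

Section Free.
Variables (n : nat) (R : idomainType).
Implicit Types (i : 'I_n) (p q r : {mpoly R[n]}).

Definition free_of i p := (size (slice i p) <= 1)%N.

Lemma free_ofP i p : free_of i p -> slice i p = p%:P.
Proof.
move=> /size1_polyC; move: (slice i p)`_0 => c eq_c.
by rewrite eq_c; congr (_%:P); rewrite -(horner_sliceX i p) eq_c hornerC.
Qed.

Lemma free_ofM i p q : free_of i p -> free_of i q -> free_of i (p * q).
Proof.
move=> /free_ofP pi /free_ofP qi.
by rewrite /free_of sliceM pi qi -polyCM size_polyC leq_b1.
Qed.

Lemma free_of_dvd i p q r : r != 0 -> p * q = r -> free_of i r -> free_of i p.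
Proof.
move=> r0 defr; have := r0; rewrite -{}defr mulf_eq0 negb_or => /andP[p0 q0].
have slice0 (u : {mpoly R[n]}) : u != 0 -> slice i u != 0.
  by apply: contraNneq => u0; apply/eqP/(@slice_inj _ _ i); rewrite u0 rmorph0.
rewrite /free_of sliceM; exact: size_factor_leq1 (slice0 p p0) (slice0 q q0).
Qed.

Lemma free_of_mmap (S : comNzRingType) (f : {rmorphism R -> S}) v i (s : S) p :
  free_of i p -> mmap f (update v i s) p = mmap f v p.
Proof. by move=> /free_ofP pi; rewrite -horner_slice pi map_polyC hornerC. Qed.

Lemma free_ofX i j : j != i -> free_of i 'X_j.
Proof. by rewrite /free_of sliceX => /negPf->; rewrite size_polyC leq_b1. Qed.

Lemma free_of_nat i k : free_of i k%:R.
Proof. by rewrite /free_of rmorph_nat -polyC_natr size_polyC leq_b1. Qed.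
End Free.

Lemma map_slice_delta (R S : comNzRingType) (f : {rmorphism R -> S})
    (v : 'I_8 -> S) :
  map_poly (mmap f v) (slice 7 (delta_mpoly R))
  = Poly (delta_coefs (v 0) (v 1) (v 2) (v 3) (v 4) (v 5) (v 6)).
Proof.
rewrite slice_delta_mpoly map_Poly (map_delta_coefs (mmap f v)).
by rewrite /= !mmapX !mmap1U.
Qed.

(** A factor of degree 1 keeps its degree under a morphism that does not kill
    the leading coefficient of the product. *)
Lemma linear_factor_root (D : idomainType) (F : fieldType) (phi : {rmorphism D -> F})
    (p q d : {poly D}) :
  p * q = d -> phi (lead_coef d) != 0 -> size p = 2%N ->
  exists x, root (map_poly phi d) x.
Proof.
move=> <-; rewrite lead_coefM rmorphM mulf_eq0 negb_or => /andP[lead_p _] size_p.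
have size_fp : size (map_poly phi p) = 2%N by rewrite size_poly_eq // size_p.
by have [x px] := poly2_root size_fp; exists x; rewrite rmorphM rootM px.
Qed.

(** Modulo 3, at a = b = e = f = g = 1 and c = d = 0, Delta becomes
    h^3 + h^2 + h + 2, which is still of degree 3 and has no root in F_3. *)
Lemma delta_mpoly_no_linear_factor (q r : {mpoly int[8]}) :
  q * r = delta_mpoly int -> size (slice 7 q) != 2%N.
Proof.
move=> defD; apply/eqP => size_q.
pose v (i : 'I_8) : 'F_3 := [:: 1; 1; 0; 0; 1; 1; 1]`_i.
have defS : slice 7 q * slice 7 r = slice 7 (delta_mpoly int).
  by rewrite -sliceM defD.
have [|x] :=
  @linear_factor_root _ _ (mmap (intr : int -> 'F_3) v) _ _ _ defS _ size_q.
  rewrite (delta_mpoly_size_lead_h int).2.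
  by rewrite 3!rmorphM rmorph_nat rmorphXn /= !mmapX !mmap1U.
rewrite map_slice_delta rootE horner_delta_coefs.
by case: x => [[|[|[|//]]] xlt]; vm_compute.
Qed.

Lemma slice6_delta_mpoly (R : comNzRingType) :
  slice 6 (delta_mpoly R) = Poly (delta_coefs 'X_1 'X_0 'X_2 'X_3 'X_4 'X_5 'X_7).
Proof.
rewrite -delta_polyX /delta_mpoly rmorph_delta /= !sliceX /=.
by rewrite delta_swap.
Qed.

Lemma mmap_delta_mpoly (R S : comNzRingType) (f : {rmorphism R -> S})
    (v : 'I_8 -> S) :
  mmap f v (delta_mpoly R)
  = delta (v 0) (v 1) (v 2) (v 3) (v 4) (v 5) (v 6) (v 7).
Proof. by rewrite /delta_mpoly rmorph_delta /= !mmapX !mmap1U. Qed.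

Lemma delta_mpoly_lead_g :
  lead_coef (slice 6 (delta_mpoly int)) = 4 * 'X_1 ^+ 3 * 'X_4 * 'X_5.
Proof.
rewrite slice6_delta_mpoly.
by have [] := @lead_delta_coefs {mpoly int[8]} 'X_1 'X_0 'X_2 'X_3 'X_4 'X_5 'X_7
  (mpoly_nat_neq0 _ 8 3) (mpolyXU_neq0 _ _) (mpolyXU_neq0 _ _) (mpolyXU_neq0 _ _).
Qed.

Lemma free_of_lead_dvd n (R : idomainType) (i : 'I_n) (p q r : {mpoly R[n]}) :
  free_of i p -> p * q = r -> exists q', p * q' = lead_coef (slice i r).
Proof.
move=> /free_ofP pi <-; exists (lead_coef (slice i q)).
by rewrite sliceM pi lead_coefM lead_coefC.
Qed.

(** A factor q free of h divides the leading coefficient 4 a^3 e f in h, so it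
    is also free of b, c, d, g; being free of g it divides 4 b^3 e f, so it is
    free of a.  The substitutions b = g = 1, c = d = h = 0, with a = 1 and with
    a = 0, do not change q and take Delta to 1 + 4 e f and to 4 e f; q divides
    their difference. *)
Lemma delta_mpoly_free_factor (q r : {mpoly int[8]}) :
  q * r = delta_mpoly int -> free_of 7 q -> q \is a GRing.unit.
Proof.
move=> defD q7.
have lead_dvd (j : 'I_8) (s : {mpoly int[8]}) i :
    q * s = 4 * 'X_j ^+ 3 * 'X_4 * 'X_5 -> i \notin [:: j; 4; 5] -> free_of i q.
  move=> defs; rewrite !inE !negb_or => /and3P[ij i4 i5].
  apply: (free_of_dvd _ defs).
    by rewrite !mulf_neq0 ?expf_neq0 ?mpolyXU_neq0 // (mpoly_nat_neq0 _ 8 3).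
  by rewrite !free_ofM ?free_of_nat ?free_ofX // eq_sym.
have [s7] := free_of_lead_dvd q7 defD.
rewrite (delta_mpoly_size_lead_h int).2 => /lead_dvd free7.
have q6 : free_of 6 q by apply: free7.
have [s6] := free_of_lead_dvd q6 defD; rewrite delta_mpoly_lead_g => /lead_dvd free6.
pose sub s0 := update (update (update (update (update (update
  (fun i => 'X_i : {mpoly int[8]}) 7 0) 6 1) 3 0) 2 0) 1 1) 0 s0.
have subq s0 : mmap (@mpolyC 8 int) (sub s0) q = q.
  rewrite free_of_mmap; last exact: free6.
  by rewrite !free_of_mmap ?free7 //; apply: mmap_polyC_id.
have defD0 s0 : q * mmap (@mpolyC 8 int) (sub s0) r
    = delta s0 1 0 0 'X_4 'X_5 1 0.
  by rewrite -{1}(subq s0) -rmorphM defD; apply: etrans (mmap_delta_mpoly _ _) _.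
apply/unitrPr.
exists (mmap (@mpolyC 8 int) (sub 1) r - mmap (@mpolyC 8 int) (sub 0) r).
by rewrite mulrBr !defD0 /delta; ring.
Qed.

Lemma cubic_factor_size (R : idomainType) (p q d : {poly R}) :
  p * q = d -> size d = 4%N -> size p != 2%N -> size q != 2%N ->
  (size p <= 1)%N || (size q <= 1)%N.
Proof.
move=> <-; have [->|p0] := eqVneq p 0; first by rewrite size_poly0.
have [->|q0] := eqVneq q 0; first by rewrite size_poly0 orbT.
rewrite size_mul //; case: (size p) (size q) => [|[|[|k]]] [|[|[|l]]] //=;
  by rewrite ?orbT // !addSn !addnS.
Qed.

(** The sizes of the two factors in h add up to 5 and none is 2, so one of the
    factors is free of h. *)
Lemma delta_mpoly_irreducible : irreducible_element (delta_mpoly int).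
Proof.
have eval0 : (delta_mpoly int).@[fun=> 0] = 0.
  by rewrite meval_delta_mpoly /delta; ring.
split.
- apply/eqP => D0; have [] := delta_mpoly_size_lead_h int.
  by rewrite D0 rmorph0 size_poly0.
- apply/negP => /unitrPr[u /(congr1 (meval (fun=> 0)))].
  by rewrite mevalM eval0 mul0r meval1.
move=> q r /esym defD.
have [sizeD _] := delta_mpoly_size_lead_h int.
have sliceD : slice 7 q * slice 7 r = slice 7 (delta_mpoly int).
  by rewrite -sliceM defD.
have defD' : r * q = delta_mpoly int by rewrite mulrC.
have /orP[q7|r7] := cubic_factor_size sliceD sizeD
  (delta_mpoly_no_linear_factor defD) (delta_mpoly_no_linear_factor defD').
- by left; apply: delta_mpoly_free_factor defD q7.
- by right; apply: delta_mpoly_free_factor defD' r7.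
Qed.

(** * Terms, degrees and conclusion *)

Lemma msupp_sum_terms n (R : nzRingType) (s : seq (R * 'X_{1..n})) :
  uniq (unzip2 s) -> all (fun t => t.1 != 0) s ->
  perm_eq (msupp (\sum_(t <- s) t.1 *: 'X_[t.2])) (unzip2 s).
Proof.
elim: s => [|[c m] s IHs]; first by rewrite big_nil msupp0.
rewrite big_cons /= => /andP[m_notin uniq_s] /andP[c0 nz_s].
have {}IHs := IHs uniq_s nz_s.
have suppX : msupp (c *: 'X_[m]) = [:: m] by rewrite msuppMCX.
apply: (@perm_trans _
  (msupp (c *: 'X_[m]) ++ msupp (\sum_(t <- s) t.1 *: 'X_[t.2]))).
  apply: msuppD => k; rewrite /= suppX inE (perm_mem IHs).
  by apply/negP => /andP[/eqP-> ]; apply/negP.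
by rewrite suppX /= perm_cons.
Qed.

(** Coefficients and exponents of the terms of Delta, as data that compute. *)
Definition delta_terms : seq (int * seq nat) :=
  [:: (1, [:: 4; 2; 0; 0; 0; 0; 0; 2]%N); (- 2, [:: 3; 3; 0; 0; 0; 0; 1; 1]%N);
      (- 2, [:: 3; 2; 1; 1; 0; 0; 0; 1]%N); (- 2, [:: 3; 1; 1; 0; 0; 1; 0; 2]%N);
      (- 2, [:: 3; 1; 0; 1; 1; 0; 0; 2]%N); (4, [:: 3; 0; 0; 0; 1; 1; 0; 3]%N);
      (1, [:: 2; 4; 0; 0; 0; 0; 2; 0]%N); (- 2, [:: 2; 3; 1; 1; 0; 0; 1; 0]%N);
      (1, [:: 2; 2; 2; 2; 0; 0; 0; 0]%N); (8, [:: 2; 2; 1; 0; 0; 1; 1; 1]%N);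
      (8, [:: 2; 2; 0; 1; 1; 0; 1; 1]%N); (4, [:: 2; 1; 2; 1; 0; 1; 0; 1]%N);
      (4, [:: 2; 1; 1; 2; 1; 0; 0; 1]%N); (- 6, [:: 2; 1; 0; 0; 1; 1; 1; 2]%N);
      (1, [:: 2; 0; 2; 0; 0; 2; 0; 2]%N); (- 10, [:: 2; 0; 1; 1; 1; 1; 0; 2]%N);
      (1, [:: 2; 0; 0; 2; 2; 0; 0; 2]%N); (- 2, [:: 1; 3; 1; 0; 0; 1; 2; 0]%N);
      (- 2, [:: 1; 3; 0; 1; 1; 0; 2; 0]%N); (4, [:: 1; 2; 2; 1; 0; 1; 1; 0]%N);
      (4, [:: 1; 2; 1; 2; 1; 0; 1; 0]%N); (- 6, [:: 1; 2; 0; 0; 1; 1; 2; 1]%N);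
      (- 2, [:: 1; 1; 3; 2; 0; 1; 0; 0]%N); (- 2, [:: 1; 1; 2; 3; 1; 0; 0; 0]%N);
      (- 10, [:: 1; 1; 2; 0; 0; 2; 1; 1]%N); (- 26, [:: 1; 1; 1; 1; 1; 1; 1; 1]%N);
      (- 10, [:: 1; 1; 0; 2; 2; 0; 1; 1]%N); (- 2, [:: 1; 0; 3; 1; 0; 2; 0; 1]%N);
      (8, [:: 1; 0; 2; 2; 1; 1; 0; 1]%N); (- 2, [:: 1; 0; 1; 3; 2; 0; 0; 1]%N);
      (18, [:: 1; 0; 1; 0; 1; 2; 1; 2]%N); (18, [:: 1; 0; 0; 1; 2; 1; 1; 2]%N);
      (4, [:: 0; 3; 0; 0; 1; 1; 3; 0]%N); (1, [:: 0; 2; 2; 0; 0; 2; 2; 0]%N);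
      (- 10, [:: 0; 2; 1; 1; 1; 1; 2; 0]%N); (1, [:: 0; 2; 0; 2; 2; 0; 2; 0]%N);
      (- 2, [:: 0; 1; 3; 1; 0; 2; 1; 0]%N); (8, [:: 0; 1; 2; 2; 1; 1; 1; 0]%N);
      (- 2, [:: 0; 1; 1; 3; 2; 0; 1; 0]%N); (18, [:: 0; 1; 1; 0; 1; 2; 2; 1]%N);
      (18, [:: 0; 1; 0; 1; 2; 1; 2; 1]%N); (1, [:: 0; 0; 4; 2; 0; 2; 0; 0]%N);
      (- 2, [:: 0; 0; 3; 3; 1; 1; 0; 0]%N); (4, [:: 0; 0; 3; 0; 0; 3; 1; 1]%N);
      (1, [:: 0; 0; 2; 4; 2; 0; 0; 0]%N); (- 6, [:: 0; 0; 2; 1; 1; 2; 1; 1]%N);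
      (- 6, [:: 0; 0; 1; 2; 2; 1; 1; 1]%N); (4, [:: 0; 0; 0; 3; 3; 0; 1; 1]%N);
      (- 27, [:: 0; 0; 0; 0; 2; 2; 2; 2]%N)].

Definition mnm_of_seq (s : seq nat) : 'X_{1..8} := [multinom nth 0%N s i | i < 8].

Lemma delta_mpolyE :
  delta_mpoly int = \sum_(t <- delta_terms) t.1 *: 'X_[mnm_of_seq t.2].
Proof.
have XE s : 'X_[mnm_of_seq s] = \prod_(i < 8) 'X_i ^+ nth 0%N s i :> {mpoly int[8]}.
  by rewrite mpolyXE_id; apply: eq_bigr => i _; rewrite mnmE.
have prod8 (F : 'I_8 -> {mpoly int[8]}) :
    \prod_i F i = F 0 * F 1 * F 2 * F 3 * F 4 * F 5 * F 6 * F 7.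
  rewrite !big_ord_recl big_ord0 mulr1 !mulrA.
  by do 7?[congr (_ * _)]; congr F; apply: val_inj.
rewrite /delta_terms unlock /= !XE.
rewrite !prod8 /= -!mul_mpolyC /delta_mpoly /delta.
move: 'X_0 'X_1 'X_2 'X_3 'X_4 'X_5 'X_6 'X_7 => ? ? ? ? ? ? ? ?.
ring.
Qed.

Lemma mdeg_mnm_of_seq s : size s = 8%N -> mdeg (mnm_of_seq s) = sumn s.
Proof.
move=> size_s; rewrite mdegE sumnE (big_nth 0%N) size_s big_mkord.
by apply: eq_bigr => i _; rewrite mnmE.
Qed.

Lemma msupp_delta_mpoly :
  perm_eq (msupp (delta_mpoly int)) [seq mnm_of_seq t.2 | t <- delta_terms].
Proof.
have := @msupp_sum_terms 8 int [seq (t.1, mnm_of_seq t.2) | t <- delta_terms].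
rewrite big_map -delta_mpolyE /unzip2 -map_comp all_map; apply; last by [].
rewrite (map_comp mnm_of_seq snd) map_inj_in_uniq //.
have size8 s : s \in unzip2 delta_terms -> size s = 8%N.
  move=> s_in; apply/eqP; move: s s_in; exact/allP.
move=> s t /size8 size_s /size8 size_t eq_st.
apply: (@eq_from_nth _ 0%N) => [|i]; rewrite size_s ?size_t // => i8.
have := congr1 (fun m : 'X_{1..8} => m (Ordinal i8)) eq_st.
by rewrite !mnmE.
Qed.

Lemma delta_mpoly_homog : delta_mpoly int \is 8.-homog.
Proof.
apply/dhomogP => m; rewrite (perm_mem msupp_delta_mpoly) => /mapP[t t_in ->].
have /allP/(_ _ t_in)/andP[/eqP size_t /eqP sum_t] :
  all (fun t => (size t.2 == 8%N) && (sumn t.2 == 8%N)) delta_terms by [].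
exact: etrans (mdeg_mnm_of_seq size_t) sum_t.
Qed.

Lemma dhomog_msizeE n (R : nzRingType) d (p : {mpoly R[n]}) :
  p != 0 -> p \is d.-homog -> msize p = d.+1.
Proof.
move=> p0 /dhomogP homog_p.
by rewrite -(mlead_deg p0); congr _.+1; apply/homog_p/mlead_supp.
Qed.

Lemma dhomogXU n (R : nzRingType) (i : 'I_n) : ('X_i : {mpoly R[n]}) \is 1.-homog.
Proof. by rewrite dhomogX; apply/eqP/mdeg1. Qed.

Lemma dhomog_nat n (R : nzRingType) k : (k%:R : {mpoly R[n]}) \is 0.-homog.
Proof. by rewrite rpredMn ?dhomog1. Qed.

Unset Implicit Arguments.

Theorem proposition2p4 (C : numClosedFieldType) :
  let a : {mpoly int[8]} := 'X_0 in let b : {mpoly int[8]} := 'X_1 in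
  let c : {mpoly int[8]} := 'X_2 in let d : {mpoly int[8]} := 'X_3 in
  let e : {mpoly int[8]} := 'X_4 in let f : {mpoly int[8]} := 'X_5 in
  let g : {mpoly int[8]} := 'X_6 in let h : {mpoly int[8]} := 'X_7 in
  let x : {mpoly {mpoly int[8]}[4]} := 'X_0 in
  let y : {mpoly {mpoly int[8]}[4]} := 'X_1 in
  let z : {mpoly {mpoly int[8]}[4]} := 'X_2 in
  let w : {mpoly {mpoly int[8]}[4]} := 'X_3 in
  let F : {mpoly {mpoly int[8]}[4]} :=
    a *: (x * y * z) + b *: (x * y * w) + c *: (x * z * w) + d *: (y * z * w)
    + e *: (x ^+ 2 * y) + f *: (x * y ^+ 2)
    + g *: (z ^+ 2 * w) + h *: (z * w ^+ 2) in
  let Delta : {mpoly int[8]} :=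
    a ^+ 4 * b ^+ 2 * h ^+ 2 - 2 * a ^+ 3 * b ^+ 3 * g * h
      - 2 * a ^+ 3 * b ^+ 2 * c * d * h - 2 * a ^+ 3 * b * c * f * h ^+ 2
      - 2 * a ^+ 3 * b * d * e * h ^+ 2 + 4 * a ^+ 3 * e * f * h ^+ 3
      + a ^+ 2 * b ^+ 4 * g ^+ 2 - 2 * a ^+ 2 * b ^+ 3 * c * d * g
      + a ^+ 2 * b ^+ 2 * c ^+ 2 * d ^+ 2 + 8 * a ^+ 2 * b ^+ 2 * c * f * g * h
      + 8 * a ^+ 2 * b ^+ 2 * d * e * g * h
      + 4 * a ^+ 2 * b * c ^+ 2 * d * f * h
      + 4 * a ^+ 2 * b * c * d ^+ 2 * e * h
      - 6 * a ^+ 2 * b * e * f * g * h ^+ 2 + a ^+ 2 * c ^+ 2 * f ^+ 2 * h ^+ 2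
      - 10 * a ^+ 2 * c * d * e * f * h ^+ 2 + a ^+ 2 * d ^+ 2 * e ^+ 2 * h ^+ 2
      - 2 * a * b ^+ 3 * c * f * g ^+ 2 - 2 * a * b ^+ 3 * d * e * g ^+ 2
      + 4 * a * b ^+ 2 * c ^+ 2 * d * f * g
      + 4 * a * b ^+ 2 * c * d ^+ 2 * e * g
      - 6 * a * b ^+ 2 * e * f * g ^+ 2 * h - 2 * a * b * c ^+ 3 * d ^+ 2 * f
      - 2 * a * b * c ^+ 2 * d ^+ 3 * e - 10 * a * b * c ^+ 2 * f ^+ 2 * g * h
      - 26 * a * b * c * d * e * f * g * h
      - 10 * a * b * d ^+ 2 * e ^+ 2 * g * h - 2 * a * c ^+ 3 * d * f ^+ 2 * h
      + 8 * a * c ^+ 2 * d ^+ 2 * e * f * h - 2 * a * c * d ^+ 3 * e ^+ 2 * h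
      + 18 * a * c * e * f ^+ 2 * g * h ^+ 2
      + 18 * a * d * e ^+ 2 * f * g * h ^+ 2 + 4 * b ^+ 3 * e * f * g ^+ 3
      + b ^+ 2 * c ^+ 2 * f ^+ 2 * g ^+ 2 - 10 * b ^+ 2 * c * d * e * f * g ^+ 2
      + b ^+ 2 * d ^+ 2 * e ^+ 2 * g ^+ 2 - 2 * b * c ^+ 3 * d * f ^+ 2 * g
      + 8 * b * c ^+ 2 * d ^+ 2 * e * f * g - 2 * b * c * d ^+ 3 * e ^+ 2 * g
      + 18 * b * c * e * f ^+ 2 * g ^+ 2 * h
      + 18 * b * d * e ^+ 2 * f * g ^+ 2 * h + c ^+ 4 * d ^+ 2 * f ^+ 2
      - 2 * c ^+ 3 * d ^+ 3 * e * f + 4 * c ^+ 3 * f ^+ 3 * g * h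
      + c ^+ 2 * d ^+ 4 * e ^+ 2 - 6 * c ^+ 2 * d * e * f ^+ 2 * g * h
      - 6 * c * d ^+ 2 * e ^+ 2 * f * g * h + 4 * d ^+ 3 * e ^+ 3 * g * h
      - 27 * e ^+ 2 * f ^+ 2 * g ^+ 2 * h ^+ 2 in
  [/\ is_A_discriminant C eight_monomials Delta,
      size (msupp Delta) = 49%N,
      Delta \is 8.-homog,
      cubic_discriminant F =
        2 ^+ 16 * 3 ^+ 5 * (e ^+ 2 * f ^+ 2 * g ^+ 2 * h ^+ 2)
        * (a * c - e * g) ^+ 2 * (a * d - f * g) ^+ 2
        * (b * c - e * h) ^+ 2 * (b * d - f * h) ^+ 2 * Delta
    & msize (cubic_discriminant F) = 33%N].
Proof.
move=> a b c d e f g h x y z w F Delta.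
have -> : Delta = delta_mpoly int by [].
have nz (i : 'I_8) : 'X_i != 0 :> {mpoly int[8]} by apply: mpolyXU_neq0.
have discE : cubic_discriminant F =
    2 ^+ 16 * 3 ^+ 5 * (e ^+ 2 * f ^+ 2 * g ^+ 2 * h ^+ 2)
    * (a * c - e * g) ^+ 2 * (a * d - f * g) ^+ 2
    * (b * c - e * h) ^+ 2 * (b * d - f * h) ^+ 2 * delta_mpoly int.
  rewrite -(cubic_discriminant_cubic a b c d e f (nz 6) (nz 7)).
  by rewrite /F /cubic !mul_mpolyC.
split=> //.
- by split; [exact: delta_mpoly_irreducible | exact: zariski_closure_singular].
- by rewrite (perm_size msupp_delta_mpoly).
- exact: delta_mpoly_homog.
apply: dhomog_msizeE; rewrite discE.
  have binomial_neq0 (i j k l : 'I_8) : (i < 4)%N -> (j < 4)%N -> (4 <= k)%N ->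
      ('X_i * 'X_j - 'X_k * 'X_l : {mpoly int[8]}) ^+ 2 != 0.
    move=> i4 j4 k4; apply: expf_neq0; pose v (m : 'I_8) : int := (m < 4)%N%:R.
    apply/eqP => /(congr1 (meval v)).
    by rewrite mevalB !mevalM !mevalXU /v i4 j4 ltnNge k4 mul0r subr0 mulr1 meval0.
  have const_neq0 : 2 ^+ 16 * 3 ^+ 5 != 0 :> {mpoly int[8]}.
    by apply: mulf_neq0; apply: expf_neq0;
      [apply: (mpoly_nat_neq0 _ 8 1) | apply: (mpoly_nat_neq0 _ 8 2)].
  apply: mulf_neq0; last by have [] := delta_mpoly_irreducible.
  do 4![apply: mulf_neq0; last exact: binomial_neq0].
  apply: (mulf_neq0 const_neq0).
  by do 3![apply: mulf_neq0; last exact/expf_neq0/nz]; apply/expf_neq0/nz.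
have homogM (p q : {mpoly int[8]}) k l : p \is k.-homog -> q \is l.-homog ->
  p * q \is (k + l).-homog by apply: dhomogM.
have homogX (p : {mpoly int[8]}) k l : p \is k.-homog -> p ^+ l \is (k * l).-homog.
  exact: dhomogMn.
have square (i : 'I_8) : ('X_i : {mpoly int[8]}) ^+ 2 \is 2.-homog.
  by apply: (homogX _ 1%N 2%N); apply: dhomogXU.
have binomial (i j k l : 'I_8) :
    ('X_i * 'X_j - 'X_k * 'X_l : {mpoly int[8]}) ^+ 2 \is 4.-homog.
  by apply: (homogX _ 2%N 2%N); rewrite rpredB //;
    apply: (homogM _ _ 1%N 1%N); apply: dhomogXU.
apply: (homogM _ _ 24%N 8%N); last exact: delta_mpoly_homog.
apply: (homogM _ _ 20%N 4%N); last exact: binomial.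
apply: (homogM _ _ 16%N 4%N); last exact: binomial.
apply: (homogM _ _ 12%N 4%N); last exact: binomial.
apply: (homogM _ _ 8%N 4%N); last exact: binomial.
apply: (homogM _ _ 0%N 8%N).
  apply: (homogM _ _ 0%N 0%N);
    [apply: (homogX _ 0%N 16%N) | apply: (homogX _ 0%N 5%N)].
    exact: (dhomog_nat _ _ 2).
  exact: (dhomog_nat _ _ 3).
apply: (homogM _ _ 6%N 2%N); last exact: square.
apply: (homogM _ _ 4%N 2%N); last exact: square.
by apply: (homogM _ _ 2%N 2%N); apply: square.
Qed.
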